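(* Let $n\geq 1$ and let $G=\mathrm{Sp}_n\times\mathrm{GL}_{2n-1}\times\cdots\times\mathrm{GL}_1$ act on the complex vector space $$V=\mathbb{C}^{2n}\oplus E_{2n},\qquad E_{2n}=\mathrm{Mat}_{2n,2n-1}\oplus\mathrm{Mat}_{2n-1,2n-2}\oplus\cdots\oplus\mathrm{Mat}_{2,1},$$ by $$(A_{2n},A_{2n-1},\ldots,A_1).(x,X_{2n-1},\ldots,X_1)=(A_{2n}x,\ A_{2n}X_{2n-1}A_{2n-1}^\top,\ A_{2n-1}X_{2n-2}A_{2n-2}^\top,\ \ldots,\ A_2X_1A_1^\top),$$ where $A_{2n}\in\mathrm{Sp}_n$, $A_k\in\mathrm{GL}_k$ for $1\le k\le 2n-1$, $x\in\mathbb{C}^{2n}$ and $X_k\in\mathrm{Mat}_{k+1,k}$. Then $(G,V)$ is a super-étale module.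
   Context: All algebraic groups are over $\mathbb{C}$. $\mathrm{Mat}_{m,k}$ is the space of complex $m\times k$-matrices. $\mathrm{Sp}_n\subset\mathrm{GL}_{2n}$ denotes the symplectic group on $\mathbb{C}^{2n}$ preserving the symplectic form $\omega$ given on the canonical basis by $\omega(e_{2j-1},e_{2j})=1$ for $j=1,\ldots,n$ and $\omega(e_{2j-1},e_k)=0=\omega(e_{2j},e_k)$ for $k\neq 2j,2j-1$. An étale module for an algebraic group $G$ is a finite-dimensional complex vector space $V$ with a rational representation of $G$ that has a Zariski-open orbit in $V$ and satisfies $\dim G=\dim V$. It is called super-étale if, in addition, the stabilizer in $G$ of any point in the open orbit is the trivial group. *)

(* Defs.v *)
From mathcomp Require Import all_boot all_order all_algebra.
From mathcomp Require Import boolp classical_sets reals.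
From mathcomp Require Import complex.
From mathcomp Require Import mpoly.

Set Implicit Arguments.
Unset Strict Implicit.
Unset Printing Implicit Defensive.

Import GRing.Theory.

Local Open Scope classical_set_scope.
Local Open Scope ring_scope.

(* A finite-dimensional vector space W is regarded as an affine space through
   its coordinates in a fixed basis; none of the notions below depends on the
   choice of that basis. *)
Section Zariski.
Variables (K : closedFieldType) (W : vectType K).

Definition poly_eval (p : {mpoly K[\dim {:W}]}) (w : W) : K :=
  p.@[fun i => coord (vbasis {:W}) i w].

Definition zariski_closed (Z : set W) : Prop :=
  exists P : set {mpoly K[\dim {:W}]},
    Z = [set w | forall p, P p -> poly_eval p w = 0].

Definition zariski_open (U : set W) : Prop := zariski_closed (~` U).

Definition locally_closed (S : set W) : Prop :=
  exists F U : set W, [/\ zariski_closed F, zariski_open U & S = F `&` U].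

Definition irreducible_set (Z : set W) : Prop :=
  Z !=set0 /\
  forall F1 F2 : set W, zariski_closed F1 -> zariski_closed F2 ->
    Z `<=` F1 `|` F2 -> Z `<=` F1 \/ Z `<=` F2.

(* Z 0 < Z 1 < ... < Z d, irreducible and closed in the subspace topology of S;
   the values Z i for i > d are irrelevant. *)
Definition irreducible_chain (S : set W) (d : nat) (Z : nat -> set W) : Prop :=
  (forall i, (i <= d)%N ->
     irreducible_set (Z i) /\
     exists2 F : set W, zariski_closed F & Z i = S `&` F) /\
  (forall i, (i < d)%N -> Z i `<` Z i.+1).

(* The dimension of a variety, as the Krull dimension of its underlying
   topological space. *)
Definition has_dim (S : set W) (d : nat) : Prop :=
  (exists Z, irreducible_chain S d Z) /\
  (forall e Z, irreducible_chain S e Z -> (e <= d)%N).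

Definition regular_fun (S : set W) (f : W -> K) : Prop :=
  forall x, S x -> exists p q : {mpoly K[\dim {:W}]},
    poly_eval q x != 0 /\
    forall y, S y -> poly_eval q y != 0 -> f y = poly_eval p y / poly_eval q y.

End Zariski.

Definition regular_map (K : closedFieldType) (W V : vectType K) (S : set W)
    (f : W -> V) : Prop :=
  forall i, regular_fun S (fun w => coord (vbasis {:V}) i (f w)).

Section AlgebraicGroups.
Variables (K : closedFieldType) (W : vectType K).
Variables (G : set W) (mul : W -> W -> W) (one : W) (inv : W -> W).

(* A linear algebraic group, realised as a locally closed subset of an affine
   space (GL_k, for instance, is open in Mat_k); the values of mul and inv
   outside of G are irrelevant. *)
Definition algebraic_group : Prop :=
  [/\ locally_closed G,
      [/\ G one, forall g h, G g -> G h -> G (mul g h)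
        & forall g, G g -> G (inv g)],
      [/\ forall g h k, G g -> G h -> G k -> mul g (mul h k) = mul (mul g h) k,
          forall g, G g -> mul one g = g /\ mul g one = g
        & forall g, G g -> mul (inv g) g = one /\ mul g (inv g) = one],
      regular_map (G `*` G) (fun gh : W * W => mul gh.1 gh.2)
    & regular_map G inv].

Variables (V : vectType K) (act : W -> V -> V).

Definition rational_representation : Prop :=
  [/\ forall g, G g -> linear (act g),
      forall v, act one v = v,
      forall g h, G g -> G h -> forall v, act (mul g h) v = act g (act h v)
    & regular_map G (fun g => linfun (act g) : 'End(V))].

Definition orbit_of (v : V) : set V := [set act g v | g in G].

Definition etale_module : Prop :=
  [/\ algebraic_group, rational_representation,
      exists v, zariski_open (orbit_of v)
    & has_dim G (\dim {:V})].

Definition super_etale_module : Prop :=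
  etale_module /\
  forall v, zariski_open (orbit_of v) ->
    [set g | G g /\ act g v = v] = [set one].

End AlgebraicGroups.

Section Tower.
Variable K : closedFieldType.

(* Mat_{m,m} + Mat_{m-1,m-1} + ... + Mat_{1,1}, up to the null summand 'M_0 *)
Fixpoint sq_tower (m : nat) : vectType K :=
  if m is k.+1 then ('M[K]_k.+1 * sq_tower k)%type else 'M[K]_0.

(* E_m = Mat_{m,m-1} + ... + Mat_{2,1}, up to the null summands Mat_{1,0}
   and 'M_0 *)
Fixpoint E_tower (m : nat) : vectType K :=
  if m is k.+1 then ('M[K]_(k.+1, k) * E_tower k)%type else 'M[K]_0.

(* The component A_m of (A_m, ..., A_1). *)
Definition top_mx (m : nat) : sq_tower m -> 'M[K]_m :=
  match m with 0 => fun A => A | k.+1 => fun A => A.1 end.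

Fixpoint tower_mul (m : nat) : sq_tower m -> sq_tower m -> sq_tower m :=
  match m with
  | 0 => fun A _ => A
  | k.+1 => fun A B => (A.1 *m B.1, tower_mul A.2 B.2)
  end.

Fixpoint tower_one (m : nat) : sq_tower m :=
  match m with
  | 0 => 1%:M
  | k.+1 => (1%:M, tower_one k)
  end.

Fixpoint tower_inv (m : nat) : sq_tower m -> sq_tower m :=
  match m with
  | 0 => fun A => A
  | k.+1 => fun A => (invmx A.1, tower_inv A.2)
  end.

(* GL_m x GL_{m-1} x ... x GL_1 *)
Fixpoint GL_tower (m : nat) : set (sq_tower m) :=
  match m with
  | 0 => setT
  | k.+1 => [set A | A.1 \in unitmx /\ GL_tower A.2]
  end.

(* (A_m X_{m-1} A_{m-1}^T, ..., A_2 X_1 A_1^T) *)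
Fixpoint E_act (m : nat) : sq_tower m -> E_tower m -> E_tower m :=
  match m with
  | 0 => fun _ X => X
  | k.+1 => fun A X => (A.1 *m X.1 *m (top_mx A.2)^T, E_act A.2 X.2)
  end.

Variable n : nat.

(* The Gram matrix of omega; with indices starting at 0, omega(e_i, e_{i+1}) = 1
   for i even. *)
Definition omega_mx : 'M[K]_n.*2 :=
  \matrix_(i, j) (if ~~ odd i && (j == i.+1 :> nat) then 1
                  else if ~~ odd j && (i == j.+1 :> nat) then -1
                  else 0).

Definition omega (x y : 'cV[K]_n.*2) : K := (x^T *m omega_mx *m y) 0 0.

Definition Sp : set 'M[K]_n.*2 :=
  [set A | A \in unitmx /\
           forall x y, omega (A *m x) (A *m y) = omega x y].

(* Sp_n x GL_{2n-1} x ... x GL_1 *)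
Definition SpGL : set (sq_tower n.*2) :=
  [set A | Sp (top_mx A) /\ GL_tower A].

Definition V_Sp : vectType K := ('cV[K]_n.*2 * E_tower n.*2)%type.

Definition V_act (A : sq_tower n.*2) (v : V_Sp) : V_Sp :=
  (top_mx A *m v.1, E_act A v.2).

End Tower.

(* Main.v *)
Require Import Defs.
From HB Require Import structures.
From mathcomp Require Import all_boot all_order all_algebra.
From mathcomp Require Import zify.
From mathcomp Require Import boolp classical_sets.
From mathcomp Require Import reals complex.
From mathcomp Require Import mpoly.

(** Write the symplectic form as a bivector P, so that A acts on it by
    P |-> A P A^T.  The symplectic group is then the stabilizer of the standard
    P, and instead of its action one may study the action of the whole tower
    GL_2n x ... x GL_1 on triples (P, x, E) with P skew.

    Generic triples of size 2n + 2 reduce to triples of size 2n.  Let X and Y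
    be the two leading matrices of E.  If the square matrix M = (x | X) is
    invertible, its inverse consists of a covector l and a projection Q, and
    P read in the basis M is given by the skew form S = Q P Q^T together with
    the vector r = Q P l^T; M uses up the leading factor of the group.  The
    skew form S has odd size and its kernel contains a unique vector k with
    r^T k = 1, so the next factor acts on the square matrix N = (k | Y) as it
    does on a frame.  In this frame nothing is left of S and r but the pair
    (Y^T S Y, Y^T r), which is acted upon by the third factor in the same way
    as (P, x) by the first.  A triple is called generic if P and M are
    invertible at every stage.

    Hence two generic triples are related by exactly one group element: its
    tail is provided by the reduced triples, and then N and M determine the
    two remaining factors (transporterP, transporter_unique).  So the generic
    vectors, which exist (generic_omega) and form an open set (open_generic),
    are a single orbit with trivial stabilizers.  Two nonempty open sets meet,
    therefore no other orbit is open.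

    As the matrices of the transporter are regular functions of the triples
    (regular_transporter), the orbit map is an isomorphism of varieties from
    the group onto the generic locus.  The dimension of the group is thereby
    the dimension of a nonempty open subset of V (has_dim_iso), and this is
    dim V (has_dim_open): coordinate subspaces give a chain of that length,
    and the polynomials which separate the members of a chain are
    algebraically independent, so that a longer chain would yield too many
    independent monomials of bounded degree. *)

Set Implicit Arguments.
Unset Strict Implicit.
Unset Printing Implicit Defensive.

Import GRing.Theory.

Local Open Scope classical_set_scope.
Local Open Scope ring_scope.

(** * Regular functions and regular maps *)

Section RegularFunctions.
Variables (K : closedFieldType) (W : vectType K).
Implicit Types (S T : set W) (f g : W -> K).

Lemma scalar_poly_eval (L : {scalar W}) :
  exists p, forall w, poly_eval p w = L w.
Proof.
exists (\sum_(i < \dim {:W}) L (vbasis {:W})`_i *: 'X_i) => w.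
rewrite /poly_eval raddf_sum [in RHS](coord_vbasis (memvf w)) linear_sum.
by apply: eq_bigr => i _; rewrite /= mevalZ mevalXU linearZ /= mulrC.
Qed.

Lemma regular_poly S p : regular_fun S (poly_eval p).
Proof.
move=> x _; exists p, 1; rewrite /poly_eval meval1 oner_neq0; split=> // y _ _.
by rewrite meval1 divr1.
Qed.

Lemma regular_ext S f g :
  (forall x, S x -> f x = g x) -> regular_fun S f -> regular_fun S g.
Proof.
move=> fg rf x Sx; have [p [q [qx pq]]] := rf x Sx.
by exists p, q; split=> // y Sy qy; rewrite -fg // pq.
Qed.

Lemma regular_subset S T f : S `<=` T -> regular_fun T f -> regular_fun S f.
Proof.
move=> ST rf x Sx; have [p [q [qx pq]]] := rf x (ST _ Sx).
by exists p, q; split=> // y Sy; apply/pq/ST.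
Qed.

Lemma regular_scalar S (L : {scalar W}) : regular_fun S L.
Proof.
have [p pL] := scalar_poly_eval L.
by apply: regular_ext (regular_poly p) => x _; rewrite pL.
Qed.

Lemma regular_cst S (c : K) : regular_fun S (fun=> c).
Proof.
apply: regular_ext (regular_poly (mpolyC _ c)) => x _.
by rewrite /poly_eval mevalC.
Qed.

Lemma regularD S f g :
  regular_fun S f -> regular_fun S g -> regular_fun S (fun w => f w + g w).
Proof.
move=> rf rg x Sx; have [p [q [qx pq]]] := rf x Sx.
have [p' [q' [q'x pq']]] := rg x Sx.
exists (p * q' + p' * q), (q * q'); rewrite /poly_eval in qx pq q'x pq' *.
rewrite mevalM mulf_neq0 //; split=> // y Sy.
rewrite mevalM mulf_eq0 negb_or => /andP[qy q'y].
by rewrite mevalD !mevalM pq // pq' // addf_div.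
Qed.

Lemma regularM S f g :
  regular_fun S f -> regular_fun S g -> regular_fun S (fun w => f w * g w).
Proof.
move=> rf rg x Sx; have [p [q [qx pq]]] := rf x Sx.
have [p' [q' [q'x pq']]] := rg x Sx.
exists (p * p'), (q * q'); rewrite /poly_eval in qx pq q'x pq' *.
rewrite mevalM mulf_neq0 //; split=> // y Sy.
rewrite mevalM mulf_eq0 negb_or => /andP[qy q'y].
by rewrite !mevalM pq // pq' // mulf_div.
Qed.

Lemma regularV S f : (forall x, S x -> f x != 0) ->
  regular_fun S f -> regular_fun S (fun w => (f w)^-1).
Proof.
move=> f0 rf x Sx; have [p [q [qx pq]]] := rf x Sx.
have px : poly_eval p x != 0.
  by apply: contraNneq (f0 x Sx) => px; rewrite pq // px mul0r.
(* the extra factor q keeps the new denominator away from the zeros of q,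
   where the fraction p / q says nothing about f *)
exists (q * q), (p * q); rewrite /poly_eval in qx pq px *.
rewrite mevalM mulf_neq0 //; split=> // y Sy.
rewrite mevalM mulf_eq0 negb_or => /andP[py qy].
by rewrite mevalM pq // invf_div -mulf_div divff // mulr1.
Qed.

Lemma regular_sum S (I : Type) (r : seq I) (P : pred I) (F : I -> W -> K) :
  (forall i, regular_fun S (F i)) ->
  regular_fun S (fun w => \sum_(i <- r | P i) F i w).
Proof.
move=> rF; elim: r => [|i r IHr].
  by apply: regular_ext (@regular_cst S 0) => x _; rewrite big_nil.
case Pi: (P i); last by apply: regular_ext IHr => x _; rewrite big_cons Pi.
by apply: regular_ext (regularD (rF i) IHr) => x _; rewrite big_cons Pi.
Qed.

Lemma regular_prod S (I : Type) (r : seq I) (P : pred I) (F : I -> W -> K) :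
  (forall i, regular_fun S (F i)) ->
  regular_fun S (fun w => \prod_(i <- r | P i) F i w).
Proof.
move=> rF; elim: r => [|i r IHr].
  by apply: regular_ext (@regular_cst S 1) => x _; rewrite big_nil.
case Pi: (P i); last by apply: regular_ext IHr => x _; rewrite big_cons Pi.
by apply: regular_ext (regularM (rF i) IHr) => x _; rewrite big_cons Pi.
Qed.

Lemma regularX S f m : regular_fun S f -> regular_fun S (fun w => f w ^+ m).
Proof.
move=> rf; apply: (@regular_ext _ (fun w => \prod_(i < m) f w)); last first.
  exact: regular_prod.
by move=> x _; rewrite prodr_const card_ord.
Qed.

End RegularFunctions.

Section RegularMaps.
Variables (K : closedFieldType) (W V : vectType K).
Implicit Types (S : set W) (T : set V).

Lemma regular_mapP S (f : W -> V) :
  regular_map S f <-> forall L : {scalar V}, regular_fun S (L \o f).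
Proof.
split=> [rf L|rf i]; last exact: rf.
apply: (@regular_ext _ _ _ (fun w =>
  \sum_(i < \dim {:V}) coord (vbasis {:V}) i (f w) * L (vbasis {:V})`_i)).
  move=> x _ /=; rewrite [in RHS](coord_vbasis (memvf (f x))) linear_sum.
  by apply: eq_bigr => i _; rewrite linearZ.
by apply: regular_sum => i; apply: regularM => //; apply: regular_cst.
Qed.

Lemma regular_map_ext S (f g : W -> V) :
  (forall x, S x -> f x = g x) -> regular_map S f -> regular_map S g.
Proof. by move=> fg rf i; apply: regular_ext (rf i) => x /fg->. Qed.

Lemma regular_comp S T (f : W -> V) (g : V -> K) :
  (forall x, S x -> T (f x)) -> regular_map S f -> regular_fun T g ->
  regular_fun S (g \o f).
Proof.
move=> fST rf rg.
have rpoly p : regular_fun S (fun w => poly_eval p (f w)).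
  apply: (@regular_ext _ _ _ (fun w => \sum_(m <- msupp p)
      p@_m * \prod_i coord (vbasis {:V}) i (f w) ^+ m i)).
    by move=> x _; rewrite /poly_eval mevalE.
  apply: regular_sum => m; apply: regularM; first exact: regular_cst.
  by apply: regular_prod => i; apply: regularX.
move=> x Sx; have [p [q [qx pq]]] := rg _ (fST _ Sx).
have [a [b [bx ab]]] := rpoly p _ Sx; have [c [d [dx cd]]] := rpoly q _ Sx.
have cx : poly_eval c x != 0.
  by apply: contraNneq qx => cx; rewrite cd // cx mul0r.
exists (a * d * d), (b * c * d); rewrite /poly_eval in bx ab dx cd cx *.
rewrite !mevalM !mulf_neq0 //; split=> // y Sy; rewrite !mevalM /=.
rewrite !mulf_eq0 !negb_or => /andP[/andP[b0 c0] d0].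
have qfy : poly_eval q (f y) != 0 by rewrite /poly_eval cd // mulf_neq0 // invr_eq0.
rewrite pq //; last exact: fST.
by rewrite /poly_eval ab // cd // invf_div mulf_div -[RHS]mulf_div divff // mulr1.
Qed.

End RegularMaps.

(** * Zariski topology *)

Section ZariskiTopology.
Variables (K : closedFieldType) (W : vectType K).
Implicit Types (S T U Z : set W) (p q : {mpoly K[\dim {:W}]}).

(** A union of principal open sets has as complement the common zeros of all
    the polynomials vanishing there, so openness can be tested point by
    point. *)
Lemma zariski_openP U : zariski_open U <->
  forall x, U x -> exists q, poly_eval q x != 0 /\
    forall y, poly_eval q y != 0 -> U y.
Proof.
split=> [[P UP] x Ux|locU].
  have : ~ (~` U) x by [].
  rewrite UP /= -existsNP => -[q /not_implyP[Pq /eqP qx]].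
  exists q; split=> // y qy; apply: contrapT => Uy.
  have : (~` U) y by [].
  by rewrite UP /= => /(_ q Pq) /eqP; rewrite (negPf qy).
exists [set q | forall y, ~ U y -> poly_eval q y = 0].
apply/seteqP; split=> [y Uy q|y /= zy Uy]; first exact.
have [q [/eqP qy qU]] := locU y Uy; apply: qy; apply: zy => z Uz.
by apply/eqP; apply: contrapT => /negP /qU.
Qed.

(** If f is p / q near w and f w is not zero, then p q separates w from the
    common zeros: where q vanishes so does p q, and elsewhere p q = f q^2. *)
Lemma relatively_closed S (P : set (W -> K)) :
  (forall f, P f -> regular_fun S f) ->
  exists2 F, zariski_closed F &
    S `&` [set w | forall f, P f -> f w = 0] = S `&` F.
Proof.
move=> rP; pose Z := S `&` [set w | forall f, P f -> f w = 0].
exists [set w | forall p, (forall z, Z z -> poly_eval p z = 0) ->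
          poly_eval p w = 0]; first by eexists.
apply/seteqP; split=> [w Zw|w [Sw wF]]; first by split; [case: Zw|move=> p; exact].
split=> // f Pf; apply/eqP; apply: contrapT => /negP fw.
have [p [q [qw pq]]] := rP f Pf w Sw.
suff: poly_eval (p * q) w = 0.
  rewrite /poly_eval mevalM => /eqP; rewrite mulf_eq0 (negPf qw) orbF => /eqP p0.
  by move: fw; rewrite pq // /poly_eval p0 mul0r eqxx.
apply: wF => z [Sz zP]; rewrite /poly_eval mevalM.
have [->|qz] := eqVneq q.@[fun i => coord (vbasis {:W}) i z] 0.
  by rewrite mulr0.
have := zP f Pf; rewrite pq // => /eqP.
rewrite mulf_eq0 invr_eq0 (negPf qz) orbF => /eqP p0.
by rewrite -/(poly_eval p z) p0 mul0r.
Qed.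

Lemma zariski_open_nonzero U f : zariski_open U -> regular_fun U f ->
  zariski_open (U `&` [set w | f w != 0]).
Proof.
move=> /zariski_openP Uo rf; apply/zariski_openP => x [Ux fx].
have [q [qx qU]] := Uo x Ux; have [a [b [bx ab]]] := rf x Ux.
exists (q * a * b); rewrite /poly_eval in qx qU bx ab *.
rewrite !mevalM !mulf_neq0 //; last first.
  by apply: contraNneq fx => ax; rewrite ab // /poly_eval ax mul0r.
split=> // y; rewrite !mevalM !mulf_eq0 !negb_or => /andP[/andP[qy ay] By].
by split; [exact: qU|rewrite /= ab ?mulf_neq0 ?invr_eq0 //; apply: qU].
Qed.

Lemma zariski_openT : zariski_open (@setT W).
Proof.
by apply/zariski_openP => x _; exists 1; rewrite /poly_eval meval1 oner_neq0.
Qed.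

(** The restrictions to the line through a and b are nonzero univariate
    polynomials, and their product has a nonzero since the field is infinite.
    This is the irreducibility of affine space in the form which also serves
    its linear subspaces. *)
Lemma line_common_nonzero p q a b : poly_eval p a != 0 -> poly_eval q b != 0 ->
  exists t, poly_eval p (a + t *: (b - a)) != 0 /\
            poly_eval q (a + t *: (b - a)) != 0.
Proof.
have restrict p' : exists P : {poly K},
    forall t, P.[t] = poly_eval p' (a + t *: (b - a)).
  exists (\sum_(m <- msupp p') (p'@_m)%:P * \prod_(i < \dim {:W})
    ((coord (vbasis {:W}) i a)%:P + (coord (vbasis {:W}) i (b - a))%:P * 'X)
      ^+ m i) => t.
  rewrite /poly_eval mevalE horner_sum; apply: eq_bigr => m _.
  rewrite hornerM hornerC horner_prod; congr (_ * _); apply: eq_bigr => i _.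
  by rewrite !hornerE [in RHS]linearD [in RHS]linearZ /= [t * _]mulrC.
have [P Pp] := restrict p; have [Q Qq] := restrict q => pa qb.
have PQ0 : P * Q != 0.
  apply: mulf_neq0.
    apply: contraNneq pa => P0.
    by have := Pp 0; rewrite P0 horner0 scale0r addr0 => <-.
  apply: contraNneq qb => Q0.
  by have := Qq 1; rewrite Q0 horner0 scale1r addrC subrK => <-.
have /closed_nonrootP[t] := PQ0.
rewrite rootE hornerM mulf_eq0 negb_or Pp Qq => /andP[pt qt].
by exists t.
Qed.

Lemma zariski_open_meet U T : zariski_open U -> zariski_open T ->
  U !=set0 -> T !=set0 -> U `&` T !=set0.
Proof.
move=> /zariski_openP Uo /zariski_openP To [a Ua] [b Tb].
have [p [pa pU]] := Uo a Ua; have [q [qb qT]] := To b Tb.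
have [t [pt qt]] := line_common_nonzero pa qb.
by exists (a + t *: (b - a)); split; [exact: pU|exact: qT].
Qed.

Lemma irreducible_polyM Z p q : irreducible_set Z ->
  (forall z, Z z -> poly_eval p z * poly_eval q z = 0) ->
  (forall z, Z z -> poly_eval p z = 0) \/ (forall z, Z z -> poly_eval q z = 0).
Proof.
move=> [_ irrZ] pq0.
have zero_closed (r : {mpoly K[\dim {:W}]}) :
    zariski_closed [set w : W | poly_eval r w = 0].
  exists [set r]; apply/seteqP; split=> w /= => [rw _ -> //|]; exact.
have [|zp|zq] := irrZ _ _ (zero_closed p) (zero_closed q); last 2 first.
- by left=> z /zp.
- by right=> z /zq.
move=> z /pq0 /eqP; rewrite mulf_eq0 => /orP[] /eqP ?; by [left|right].
Qed.

End ZariskiTopology.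

(** * Dimension of open subsets of a vector space *)

Section PolynomialDependence.
Variable K : fieldType.

(** All exponents of such a monomial are at most N. *)
Lemma card_bmultinom d N : (#|{: 'X_{1..d < N.+1}}| <= N.+1 ^ d)%N.
Proof.
have -> : (N.+1 ^ d = #|{: {ffun 'I_d -> 'I_N.+1}}|)%N.
  by rewrite card_ffun !card_ord.
pose f (m : 'X_{1..d < N.+1}) := [ffun i => inord (m i) : 'I_N.+1].
apply: (@leq_card _ _ f) => m1 m2 /ffunP f12; apply/val_inj/mnmP => i.
have lemN (m : 'X_{1..d < N.+1}) : (m i < N.+1)%N.
  by apply: leq_ltn_trans (bmdeg m); rewrite mdegE (bigD1 i) //= leq_addr.
by have /(congr1 val) := f12 i; rewrite !ffunE /= !inordK.
Qed.

Lemma leq_msizeM d (p q : {mpoly K[d]}) a b :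
  (msize p <= a.+1)%N -> (msize q <= b.+1)%N -> (msize (p * q) <= (a + b).+1)%N.
Proof.
have [->|p0] := eqVneq p 0; first by rewrite mul0r msize0.
have [->|q0] := eqVneq q 0; first by rewrite mulr0 msize0.
move=> sp sq; rewrite msizeM // -subn1 leq_subLR.
by rewrite (leq_trans (leq_add sp sq)) // addSn addnS.
Qed.

Lemma mpoly_dependent d N (I : finType) (B : I -> {mpoly K[d]}) :
  (forall i, msize (B i) <= N.+1)%N -> (N.+1 ^ d < #|I|)%N ->
  exists2 c : I -> K, exists i, c i != 0 & \sum_i c i *: B i = 0.
Proof.
move=> sB ltI; pose X := {: 'X_{1..d < N.+1}}.
pose A := \matrix_(i < #|I|, j < #|X|) (B (enum_val i))@_(enum_val j).
have : kermx A != 0.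
  rewrite kermx_eq0 /row_free neq_ltn (leq_ltn_trans (rank_leq_col A)) //.
  exact: leq_ltn_trans (card_bmultinom d N) ltI.
case/rowV0Pn=> v /sub_kermxP vA v0.
have [i0 vi0] : exists i, v 0 i != 0.
  apply: contrapT => noi; case/eqP: v0; apply/rowP => i; rewrite mxE.
  by apply/eqP; apply: contrapT => /negP vi; apply: noi; exists i.
exists (fun i => v 0 (enum_rank i)).
  by exists (enum_val i0); rewrite enum_valK.
apply/mpolyP => m; rewrite raddf_sum mcoeff0 /=.
have [ltm|lem] := ltnP (mdeg m) N.+1; last first.
  rewrite big1 // => i _; rewrite mcoeffZ memN_msupp_eq0 ?mulr0 //.
  by apply/negP => /msize_mdeg_lt; rewrite ltnNge (leq_trans (sB i) lem).
have /rowP/(_ (enum_rank (BMultinom ltm : X))) := vA.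
rewrite !mxE => vAm; rewrite -[RHS]vAm.
rewrite (reindex (fun i : 'I_#|I| => enum_val i)) /=; last first.
  by apply: onW_bij; apply: enum_val_bij.
by apply: eq_bigr => i _; rewrite mcoeffZ enum_valK mxE enum_rankK.
Qed.

End PolynomialDependence.

Section Dimension.
Variables (K : closedFieldType) (V : vectType K).
Local Notation d := (\dim {:V}).
Implicit Types (U Z : set V) (p q : {mpoly K[d]}).

Definition independent_on Z (I : finType) (B : I -> {mpoly K[d]}) :=
  forall c : I -> K,
    (forall z, Z z -> \sum_i c i * poly_eval (B i) z = 0) -> forall i, c i = 0.

(** In a nontrivial relation on Z', the lowest power of p can be cancelled
    because Z' is irreducible; restricted to Z, where p is zero, what remains
    is a nontrivial relation between the B i. *)
Lemma independent_powers Z Z' p (I : finType) (B : I -> {mpoly K[d]}) s :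
  irreducible_set Z' -> Z `<=` Z' -> (forall z, Z z -> poly_eval p z = 0) ->
  (exists2 z, Z' z & poly_eval p z != 0) -> independent_on Z B ->
  independent_on Z' (fun ij : I * 'I_s.+1 => p ^+ ij.2 * B ij.1).
Proof.
move=> irrZ' ZZ' pZ [z0 Z'z0 pz0] indB c c0.
apply: contrapT => /existsNP[[i0 j0] /eqP ci0].
pose nz (j : 'I_s.+1) := [exists i, c (i, j) != 0].
have nzj0 : nz j0 by apply/existsP; exists i0.
(* p ^+ j is the lowest power of p in the relation, and q the cofactor *)
case: (arg_minnP (fun j : 'I_s.+1 => j : nat) nzj0) => j /existsP[i cij] minj.
pose q := \sum_(k : 'I_s.+1 | (j <= k)%N)
            p ^+ (k - j) * \sum_i c (i, k) *: B i.
have evq z : poly_eval q z = \sum_(k : 'I_s.+1 | (j <= k)%N)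
    poly_eval p z ^+ (k - j) * \sum_i c (i, k) * poly_eval (B i) z.
  rewrite /poly_eval raddf_sum; apply: eq_bigr => k _ /=.
  rewrite mevalM rmorphXn raddf_sum /=; congr (_ * _).
  by apply: eq_bigr => i' _ /=; rewrite mevalZ.
have pq0 z : Z' z -> poly_eval (p ^+ j) z * poly_eval q z = 0.
  move=> /c0 <-; rewrite evq mulr_sumr.
  rewrite [RHS](eq_bigr (fun ij => c (ij.1, ij.2) *
    poly_eval (p ^+ ij.2 * B ij.1) z)); last by case.
  rewrite -(pair_bigA _ (fun i' (k : 'I_s.+1) =>
    c (i', k) * poly_eval (p ^+ k * B i') z)) /= exchange_big /=.
  rewrite [RHS](bigID (fun k : 'I_s.+1 => (j <= k)%N)) /=.
  rewrite [X in _ = _ + X]big1 ?addr0 => [|k ltkj]; last first.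
    apply: big1 => i' _; have [->|ck] := eqVneq (c (i', k)) 0.
      by rewrite mul0r.
    by case/negP: ltkj; apply: minj; apply/existsP; exists i'.
  apply: eq_bigr => k lejk; rewrite mulrA /poly_eval rmorphXn -exprD subnKC //.
  rewrite mulr_sumr; apply: eq_bigr => i' _; rewrite mevalM rmorphXn.
  by rewrite mulrCA.
have [pj0|q0] := irreducible_polyM irrZ' pq0.
  have /eqP := pj0 z0 Z'z0; rewrite /poly_eval rmorphXn expf_eq0.
  by case/andP=> _; apply/negP.
suff /indB/(_ i)/eqP : forall z, Z z -> \sum_i c (i, j) * poly_eval (B i) z = 0.
  by rewrite (negPf cij).
move=> z Zz; have := q0 z (ZZ' z Zz); rewrite evq (bigD1 j) //= subnn mul1r.
rewrite pZ // [X in _ + X]big1 ?addr0 // => k /andP[lejk kj].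
by rewrite expr0n subn_eq0 leqNgt ltn_neqAle lejk eq_sym kj mul0r.
Qed.

(** Each step of a chain supplies a polynomial that vanishes on the smaller
    set but not on the larger one, and these polynomials are algebraically
    independent.  Stated for the monomials with all exponents at most s, the
    independence can be compared with the dimension of a space of polynomials
    of bounded degree. *)
Lemma chain_independent (Z : nat -> set V) (p : nat -> {mpoly K[d]}) D s e :
  (forall i, (i <= e)%N -> irreducible_set (Z i)) ->
  (forall i, (i < e)%N -> Z i `<=` Z i.+1) ->
  (forall i, (i < e)%N -> [/\ forall z, Z i z -> poly_eval (p i) z = 0,
     exists2 z, Z i.+1 z & poly_eval (p i) z != 0 & (msize (p i) <= D.+1)%N]) ->
  exists (I : finType) (B : I -> {mpoly K[d]}),
    [/\ #|I| = (s.+1 ^ e)%N, forall i, (msize (B i) <= (e * s * D).+1)%N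
      & independent_on (Z e) B].
Proof.
elim: e => [|e IHe] irrZ incZ pZ.
  exists unit, (fun=> 1); split=> [|_|c c0 []]; first by rewrite card_unit.
    by rewrite msize1.
  have [[z Zz] _] := irrZ 0%N isT.
  have := c0 z Zz; rewrite (bigD1 tt) //= big1 => [|[] //].
  by rewrite addr0 /poly_eval meval1 mulr1.
have [|||I [B [cardI sizeB indB]]] := IHe.
- by move=> i lei; apply/irrZ/leqW.
- by move=> i lti; apply/incZ/ltnW.
- by move=> i lti; apply/pZ/ltnW.
have [pe0 pe1 sizep] := pZ e (ltnSn e).
exists (I * 'I_s.+1)%type, (fun ij : I * 'I_s.+1 => p e ^+ ij.2 * B ij.1); split.
- by rewrite card_prod card_ord cardI expnSr.
- case=> i j /=; have sizepX k : (msize (p e ^+ k) <= (k * D).+1)%N.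
    elim: k => [|k IHk]; first by rewrite expr0 msize1.
    by rewrite exprS mulSn leq_msizeM.
  apply: leq_trans (leq_msizeM (sizepX j) (sizeB i)) _.
  by rewrite mulSn mulnDl ltnS leq_add2r leq_mul2r -ltnS ltn_ord orbT.
- apply: independent_powers indB => //; [exact: irrZ | exact: incZ].
Qed.

(** The (s + 1)^e independent monomials have degree at most e s D, so they
    number at most (e s D + 1)^d, which for large s forces e <= d. *)
Lemma chain_length U e (Z : nat -> set V) : irreducible_chain U e Z -> (e <= d)%N.
Proof.
move=> [irrZ ltZ]; rewrite leqNgt; apply/negP => ltde.
have /choice[p pP] : forall i, exists p, (i < e)%N ->
    (forall z, Z i z -> poly_eval p z = 0) /\
    exists2 z, Z i.+1 z & poly_eval p z != 0.
  move=> i; have [lti|_] := ltnP i e; last by exists 0.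
  have [_ [F [P FP] ZF]] := irrZ i (ltnW lti).
  have [_ [F' _ ZF']] := irrZ i.+1 lti.
  have [ZZ' /existsNP[z /not_implyP[Z'z Zz]]] := ltZ i lti.
  have : ~ F z by move=> Fz; apply: Zz; rewrite ZF; move: Z'z; rewrite ZF' => -[].
  rewrite FP /= -existsNP => -[p /not_implyP[Pp /eqP pz]].
  exists p => _; split=> [y|]; last by exists z.
  by rewrite ZF FP => -[_]; exact.
pose D := \max_(i < e) msize (p i).
(* this s is large enough: (e s D + 1)^d <= (e D + 1)^d (s + 1)^d, and the
   first factor is less than s + 1 *)
pose s := ((e * D).+1 ^ d)%N.
have [|||I [B [cardI sizeB indB]]] := @chain_independent Z p D s e.
- by move=> i lei; case: (irrZ i lei).
- by move=> i lti; case: (ltZ i lti).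
- move=> i lti; have [pZ pZ'] := pP i lti; split=> //; apply: leqW.
  exact: (leq_bigmax (Ordinal lti)).
have [|c [i ci] cB] := mpoly_dependent sizeB; last first.
  case/eqP: ci; apply: (indB c) => z _.
  transitivity (poly_eval (\sum_i c i *: B i) z).
    rewrite /poly_eval raddf_sum; apply: eq_bigr => j _ /=.
    by rewrite mevalZ.
  by rewrite cB /poly_eval meval0.
rewrite cardI; apply: (@leq_trans (s.+1 ^ d.+1)%N); last by rewrite leq_pexp2l.
have leNs : ((e * s * D).+1 <= (e * D).+1 * s.+1)%N by nia.
apply: (@leq_ltn_trans (((e * D).+1 * s.+1) ^ d)%N).
  by case: (d) => // d'; rewrite leq_exp2r.
by rewrite expnMn -/s expnS ltn_pmul2r ?expn_gt0.
Qed.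

(** The slices of U by the coordinate subspaces through u are irreducible
    because the line joining two points of a slice stays in the subspace and
    is generically in U. *)
Lemma coordinate_chain U u : zariski_open U -> U u ->
  irreducible_chain U d (fun i => U `&`
    [set w | forall j : 'I_d, (i <= j)%N ->
       coord (vbasis {:V}) j w = coord (vbasis {:V}) j u]).
Proof.
move=> /zariski_openP Uo Uu.
have dir_coord (j k : 'I_d) t :
    coord (vbasis {:V}) k (u + t *: (vbasis {:V})`_j) =
      coord (vbasis {:V}) k u + t *+ (k == j).
  rewrite linearD linearZ /= coord_free ?(basis_free (vbasisP _)) //.
  by rewrite eq_sym mulr_natr.
split=> [i _|i ltid]; last first.
  split=> [w [Uw wi]|]; first by split=> // j ltij; apply/wi/ltnW.
  pose j := Ordinal ltid; pose b := (vbasis {:V})`_j.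
  have [q [qu qU]] := Uo u Uu.
  pose x : {mpoly K[d]} := 'X_j - (coord (vbasis {:V}) j u)%:MP.
  have evx w : poly_eval x w =
      coord (vbasis {:V}) j w - coord (vbasis {:V}) j u.
    by rewrite /poly_eval mevalB mevalXU mevalC.
  have xb : poly_eval x (u + b) != 0.
    by rewrite evx -[b]scale1r dir_coord eqxx addrC addKr oner_neq0.
  have [t] := line_common_nonzero qu xb.
  rewrite [u + b]addrC addrK => -[qt xt] incZ.
  have [|_ /(_ j (leqnn _))] := incZ (u + t *: b).
    split=> [|k ltik]; first exact: qU.
    by rewrite dir_coord -val_eqE /= gtn_eqF // addr0.
  by move=> /eqP; rewrite -subr_eq0 -evx (negPf xt).
pose L := [set w | forall j : 'I_d, (i <= j)%N ->
  coord (vbasis {:V}) j w = coord (vbasis {:V}) j u].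
split; last first.
  exists L => //; exists [set p | forall w, L w -> poly_eval p w = 0].
  apply/seteqP; split=> [w Lw p|w wP j leij]; first exact.
  pose x : {mpoly K[d]} := 'X_j - (coord (vbasis {:V}) j u)%:MP.
  suff /eqP : poly_eval x w = 0.
    by rewrite /poly_eval mevalB mevalXU mevalC subr_eq0 => /eqP.
  apply: wP => y /(_ j leij) yj.
  by rewrite /poly_eval mevalB mevalXU mevalC yj subrr.
split; first by exists u.
move=> F1 F2 [P1 ->] [P2 ->] cover; apply: contrapT => /not_orP[].
move=> /existsNP[a /not_implyP[[Ua La]]].
rewrite -existsNP => -[p1 /not_implyP[P1p1 /eqP p1a]].
move=> /existsNP[b /not_implyP[[Ub Lb]]].
rewrite -existsNP => -[p2 /not_implyP[P2p2 /eqP p2b]].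
have [q1 [q1a q1U]] := Uo a Ua.
(* q1 keeps the point found on the line inside U *)
have p1q1a : poly_eval (p1 * q1) a != 0 by rewrite /poly_eval mevalM mulf_neq0.
have [t] := line_common_nonzero p1q1a p2b.
rewrite {1}/poly_eval mevalM mulf_eq0 negb_or => -[/andP[p1t /q1U Ut] p2t].
have Zt : (U `&` L) (a + t *: (b - a)).
  split=> // j leij.
  by rewrite linearD linearZ linearB /= La // Lb // subrr mulr0 addr0.
have [/(_ _ P1p1) /eqP|/(_ _ P2p2) /eqP] := cover _ Zt.
  exact/negP.
exact/negP.
Qed.

Lemma has_dim_open U : zariski_open U -> U !=set0 -> has_dim U d.
Proof.
move=> Uo [u Uu]; split; last exact: chain_length.
by eexists; apply: coordinate_chain Uo Uu.
Qed.

End Dimension.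

(** * Invariance of the dimension under isomorphism *)

Section DimensionInvariance.
Variables (K : closedFieldType).

Lemma regular_preimage_closed (W V : vectType K) (S : set W) (f : W -> V)
    (F : set V) : regular_map S f -> zariski_closed F ->
  exists2 E, zariski_closed E & S `&` f @^-1` F = S `&` E.
Proof.
move=> rf [P ->]; pose Q := [set g : W -> K | exists2 p, P p & g = poly_eval p \o f].
have [g [p _ ->]|E Ecl SE] := @relatively_closed _ _ S Q.
  exact: (@regular_comp _ _ _ S setT) rf (regular_poly p).
exists E => //; rewrite -SE; apply/seteqP; split=> w [Sw wP]; split=> //.
  by move=> _ [p Pp ->]; apply: wP.
by move=> p Pp; apply: (wP (poly_eval p \o f)); exists p.
Qed.

Variables (W V : vectType K) (S : set W) (T : set V).
Variables (f : W -> V) (g : V -> W).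
Hypotheses (rf : regular_map S f) (rg : regular_map T g).
Hypotheses (fS : forall x, S x -> T (f x)) (gT : forall y, T y -> S (g y)).
Hypotheses (gf : forall x, S x -> g (f x) = x).
Hypotheses (fg : forall y, T y -> f (g y) = y).

(** As a bijection continuous in both directions, f carries the members of a
    chain to their preimages under g. *)
Lemma irreducible_chain_iso d Z : irreducible_chain S d Z ->
  irreducible_chain T d (fun i => T `&` g @^-1` Z i).
Proof.
move=> [irrZ ltZ].
have subZ i : (i <= d)%N -> Z i `<=` S.
  by move=> /irrZ[_ [F _ ->]] w [].
have fZ i z : (i <= d)%N -> Z i z -> (T `&` g @^-1` Z i) (f z).
  by move=> lei Zz; have Sz := subZ i lei z Zz; split; [exact: fS|rewrite /= gf].
split=> i lei; last first.
  have [incZ /existsNP[z /not_implyP[Z'z Zz]]] := ltZ i lei.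
  split=> [y [Ty Zy]|/(_ (f z) (fZ _ _ lei Z'z))[_ /=]].
    by split=> //; apply: incZ.
  by rewrite gf //; apply: subZ Z'z.
have [[[z0 Z0] irr] [F Fcl ZF]] := irrZ i lei; split.
  split=> [|F1 F2 F1cl F2cl cover]; first by exists (f z0); apply: fZ.
  have [E1 E1cl SE1] := regular_preimage_closed rf F1cl.
  have [E2 E2cl SE2] := regular_preimage_closed rf F2cl.
  have [z Zz|ZE|ZE] := irr E1 E2 E1cl E2cl.
  - have Sz := subZ _ lei _ Zz.
    case: (cover _ (fZ _ _ lei Zz)) => Fz; [left|right].
      by have : (S `&` f @^-1` F1) z by []; rewrite SE1 => -[].
    by have : (S `&` f @^-1` F2) z by []; rewrite SE2 => -[].
  - left=> y [Ty Zy]; have : (S `&` E1) (g y) by split; [exact: gT|exact: ZE].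
    by rewrite -SE1 => -[_ /=]; rewrite fg.
  - right=> y [Ty Zy]; have : (S `&` E2) (g y) by split; [exact: gT|exact: ZE].
    by rewrite -SE2 => -[_ /=]; rewrite fg.
have [E Ecl TE] := regular_preimage_closed rg Fcl; exists E => //.
rewrite -TE; apply/seteqP; split=> y [Ty /=]; rewrite ?ZF.
  by move=> [_ Fy].
by move=> Fy; split=> //=; split=> //; apply: gT.
Qed.

End DimensionInvariance.

Lemma has_dim_iso (K : closedFieldType) (W V : vectType K) (S : set W)
    (T : set V) (f : W -> V) (g : V -> W) d :
  regular_map S f -> regular_map T g ->
  (forall x, S x -> T (f x)) -> (forall y, T y -> S (g y)) ->
  (forall x, S x -> g (f x) = x) -> (forall y, T y -> f (g y) = y) ->
  has_dim T d -> has_dim S d.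
Proof.
move=> rf rg fS gT gf fg [[Z chZ] maxT]; split.
  by exists (fun i => S `&` f @^-1` Z i); apply: irreducible_chain_iso chZ.
by move=> e Y /(irreducible_chain_iso rf rg fS gT gf fg) /maxT.
Qed.

(** * Frames and the reduction of a skew bivector *)

Lemma invmx_mul (K : comUnitRingType) n (A B : 'M[K]_n) :
  A \in unitmx -> B \in unitmx -> invmx (A *m B) = invmx B *m invmx A.
Proof.
move=> uA uB; have uAB : A *m B \in unitmx by rewrite unitmx_mul uA.
by apply: (can_inj (mulKmx uAB)); rewrite mulmxV // -mulmxA mulKVmx // mulmxV.
Qed.

Section Frame.
Variables (K : fieldType) (a : nat).
Implicit Types (P : 'M[K]_(1 + a)) (x : 'cV[K]_(1 + a)) (X : 'M[K]_(1 + a, a)).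

(** The basis of the ambient space formed by x and the columns of X, together
    with its dual basis: coframe_vec is the coordinate along x, coframe_proj
    the coordinates along X. *)
Definition frame x X : 'M_(1 + a) := row_mx x X.
Definition coframe_vec x X : 'rV_(1 + a) := usubmx (invmx (frame x X)).
Definition coframe_proj x X : 'M_(a, 1 + a) := dsubmx (invmx (frame x X)).
(** The blocks of the bivector P in that basis, see form_of_induced. *)
Definition induced_form P x X : 'M_a :=
  coframe_proj x X *m P *m (coframe_proj x X)^T.
Definition induced_vec P x X : 'cV_a :=
  coframe_proj x X *m P *m (coframe_vec x X)^T.
(** The pairing of the columns of X with x under the symplectic form - P^-1.
    It spans the kernel of induced_form, and a formula without the inverse
    frame makes its regularity and its equivariance immediate. *)
Definition kernel_vec P x X : 'cV_a := - (X^T *m invmx P *m x).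

Lemma frame_mulV x X : frame x X \in unitmx ->
  x *m coframe_vec x X + X *m coframe_proj x X = 1%:M.
Proof. by move=> uM; rewrite -mul_row_col vsubmxK mulmxV. Qed.

Lemma frame_mulK x X : frame x X \in unitmx ->
  [/\ coframe_vec x X *m x = 1%:M, coframe_vec x X *m X = 0,
      coframe_proj x X *m x = 0 & coframe_proj x X *m X = 1%:M].
Proof.
move=> uM; have := mulVmx uM.
rewrite -[invmx _]vsubmxK mul_col_row scalar_mx_block.
by move=> /eq_block_mx[].
Qed.

Lemma coframe_unique x X (l : 'rV_(1 + a)) (Q : 'M_(a, 1 + a)) :
  l *m x = 1%:M -> l *m X = 0 -> Q *m x = 0 -> Q *m X = 1%:M ->
  [/\ frame x X \in unitmx, coframe_vec x X = l & coframe_proj x X = Q].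
Proof.
move=> lx lX Qx QX.
have lQM : col_mx l Q *m frame x X = 1%:M.
  by rewrite mul_col_row lx lX Qx QX -scalar_mx_block.
have [_ uM] := mulmx1_unit lQM.
have VM : invmx (frame x X) = col_mx l Q.
  by rewrite -[LHS]mul1mx -lQM mulmxK.
by split=> //; rewrite /coframe_vec /coframe_proj VM (col_mxKu, col_mxKd).
Qed.

Hypothesis two_neq0 : 2%:R != 0 :> K.

Lemma skew_quad b (P : 'M[K]_b) (u : 'rV_b) : P^T = - P -> u *m P *m u^T = 0.
Proof.
move=> skP; set q := _ *m _.
have qN : q = - q.
  have qT : q = q^T by apply/matrixP => i j; rewrite !ord1 [RHS]mxE.
  by rewrite {1}qT /q !trmx_mul trmxK skP mulNmx mulmxN mulmxA.
apply/matrixP => i j; have /matrixP/(_ i j) := qN; rewrite !mxE => /eqP.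
by rewrite -addr_eq0 -mulr2n -mulr_natl mulf_eq0 (negPf two_neq0) => /eqP.
Qed.

Section Skew.
Variables (P : 'M[K]_(1 + a)) (x : 'cV[K]_(1 + a)) (X : 'M[K]_(1 + a, a)).
Hypotheses (skP : P^T = - P) (uM : frame x X \in unitmx).
Let l := coframe_vec x X.
Let Q := coframe_proj x X.
Let S := induced_form P x X.
Let r := induced_vec P x X.
Let k := kernel_vec P x X.

Lemma induced_form_skew : S^T = - S.
Proof.
by rewrite /S /induced_form !trmx_mul trmxK skP mulNmx mulmxN mulmxA.
Qed.

Lemma induced_vec_tr : r^T = - (l *m P *m Q^T).
Proof. by rewrite /r /induced_vec !trmx_mul trmxK skP mulNmx mulmxN mulmxA. Qed.

(** In the basis of the columns of frame x X, the bivector P has the blocks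
    0, - r^T, r and S; the first one is zero because P is skew. *)
Lemma form_of_induced :
  P = X *m r *m x^T - x *m r^T *m X^T + X *m S *m X^T.
Proof.
have xXlQ := frame_mulV uM; rewrite -/l -/Q in xXlQ.
have lPl : l *m P *m l^T = 0 by apply: skew_quad.
have {1}-> : P = (x *m l + X *m Q) *m P *m (x *m l + X *m Q)^T.
  by rewrite xXlQ trmx1 mul1mx mulmx1.
have -> : x *m r^T *m X^T = - (x *m (l *m P *m Q^T) *m X^T).
  by rewrite induced_vec_tr mulmxN mulNmx.
have -> : (x *m l + X *m Q) *m P *m (x *m l + X *m Q)^T =
    x *m (l *m P *m l^T) *m x^T + x *m (l *m P *m Q^T) *m X^T +
    (X *m (Q *m P *m l^T) *m x^T + X *m (Q *m P *m Q^T) *m X^T).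
  by rewrite linearD /= !trmx_mul !mulmxDl !mulmxDr !mulmxA.
by rewrite lPl mulmx0 mul0mx add0r opprK addrCA addrA.
Qed.

Hypothesis uP : P \in unitmx.

Lemma skew_invmx : (invmx P)^T = - invmx P.
Proof.
have uNP : - P \in unitmx by rewrite -skP unitmx_tr.
rewrite trmx_inv skP.
by apply: (can_inj (mulKmx uNP)); rewrite mulmxV // mulNmx mulmxN opprK mulmxV.
Qed.

(** Multiplication by k undoes P up to sign: the correction term that comes
    from X Q = 1 - x l contains x^T P^-1 x, which is zero. *)
Lemma kernel_vecE b (R : 'M_(b, 1 + a)) :
  R *m P *m Q^T *m k = - (R *m x).
Proof.
have -> : R *m P *m Q^T *m k = - (R *m P *m (X *m Q)^T *m invmx P *m x).
  by rewrite /k /kernel_vec mulmxN trmx_mul !mulmxA.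
have -> : X *m Q = 1%:M - x *m l by rewrite -(frame_mulV uM) addrC addKr.
rewrite linearB /= trmx1 trmx_mul mulmxBr mulmx1 !mulmxBl mulmxK //.
have xPx : x^T *m invmx P *m x = 0.
  by rewrite -{2}[x]trmxK; apply: skew_quad skew_invmx.
by rewrite -!mulmxA [x^T *m _]mulmxA xPx !mulmx0 subr0.
Qed.

Lemma induced_form_kernel : S *m k = 0.
Proof.
have [_ _ Qx _] := frame_mulK uM.
by rewrite /S /induced_form kernel_vecE Qx oppr0.
Qed.

Lemma induced_vec_kernel : r^T *m k = 1%:M.
Proof.
have [lx _ _ _] := frame_mulK uM.
by rewrite induced_vec_tr mulNmx kernel_vecE lx opprK.
Qed.

End Skew.

End Frame.

Section FrameAction.
Variables (K : fieldType) (a : nat).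
Implicit Types (P A : 'M[K]_(1 + a)) (B : 'M[K]_a).
Implicit Types (x : 'cV[K]_(1 + a)) (X : 'M[K]_(1 + a, a)).

Definition ext_mx B : 'M_(1 + a) := block_mx 1%:M 0 0 B.

Lemma ext_mx_tr B : (ext_mx B)^T = ext_mx B^T.
Proof. by rewrite tr_block_mx trmx1 !trmx0. Qed.

Lemma ext_mx_unit B : (ext_mx B \in unitmx) = (B \in unitmx).
Proof. by rewrite !unitmxE det_ublock det1 mul1r. Qed.

Lemma frame_act A B x X :
  frame (A *m x) (A *m X *m B^T) = A *m frame x X *m ext_mx B^T.
Proof.
rewrite /frame /ext_mx mul_mx_row mul_row_block.
by rewrite !mulmx0 mulmx1 addr0 add0r.
Qed.

Variables (A : 'M[K]_(1 + a)) (B : 'M[K]_a).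
Hypotheses (uA : A \in unitmx) (uB : B \in unitmx).
Variables (P : 'M[K]_(1 + a)) (x : 'cV[K]_(1 + a)) (X : 'M[K]_(1 + a, a)).
Hypothesis uM : frame x X \in unitmx.

Lemma coframe_act :
  [/\ frame (A *m x) (A *m X *m B^T) \in unitmx,
      coframe_vec (A *m x) (A *m X *m B^T) = coframe_vec x X *m invmx A
    & coframe_proj (A *m x) (A *m X *m B^T) =
        (invmx B)^T *m coframe_proj x X *m invmx A].
Proof.
have [lx lX Qx QX] := frame_mulK uM.
apply: coframe_unique; rewrite !mulmxA ?mulmxKV //.
- by rewrite lX mul0mx.
- by rewrite -mulmxA Qx mulmx0.
- by rewrite -(mulmxA _ _ X) QX mulmx1 -trmx_mul mulmxV // trmx1.
Qed.

Lemma induced_form_act :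
  induced_form (A *m P *m A^T) (A *m x) (A *m X *m B^T) =
    (invmx B)^T *m induced_form P x X *m invmx B.
Proof.
have [_ _ QE] := coframe_act.
rewrite /induced_form QE !trmx_mul trmxK !mulmxA mulmxKV //.
by rewrite (trmx_inv A) mulmxK // unitmx_tr.
Qed.

Lemma induced_vec_act :
  induced_vec (A *m P *m A^T) (A *m x) (A *m X *m B^T) =
    (invmx B)^T *m induced_vec P x X.
Proof.
have [_ lE QE] := coframe_act.
rewrite /induced_vec lE QE !trmx_mul !mulmxA mulmxKV //.
by rewrite (trmx_inv A) mulmxK // unitmx_tr.
Qed.

Lemma kernel_vec_act : P \in unitmx ->
  kernel_vec (A *m P *m A^T) (A *m x) (A *m X *m B^T) = B *m kernel_vec P x X.
Proof.
move=> uP; have uAT : A^T \in unitmx by rewrite unitmx_tr.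
rewrite /kernel_vec !invmx_mul ?unitmx_mul ?uA // !trmx_mul trmxK mulmxN.
by rewrite !mulmxA mulmxK // mulmxKV.
Qed.

End FrameAction.

Section Reduction.
Variables (K : fieldType) (m : nat).
Implicit Types (P : 'M[K]_(1 + (1 + m))) (x : 'cV[K]_(1 + (1 + m))).
Implicit Types (X : 'M[K]_(1 + (1 + m), 1 + m)) (Y : 'M[K]_(1 + m, m)).

(** What remains of P and x once the frames of the two leading spaces are
    normalized: a bivector and a vector in the third space. *)
Definition reduced_form P x X Y : 'M_m := Y^T *m induced_form P x X *m Y.
Definition reduced_vec P x X Y : 'cV_m := Y^T *m induced_vec P x X.
Definition kernel_frame P x X Y : 'M_(1 + m) := frame (kernel_vec P x X) Y.

(** B cancels, so the pair obeys the transformation law of (P, x) with C in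
    the role of A. *)
Lemma reduced_act A B (C : 'M[K]_m) P x X Y :
  A \in unitmx -> B \in unitmx -> frame x X \in unitmx ->
  reduced_form (A *m P *m A^T) (A *m x) (A *m X *m B^T) (B *m Y *m C^T) =
    C *m reduced_form P x X Y *m C^T /\
  reduced_vec (A *m P *m A^T) (A *m x) (A *m X *m B^T) (B *m Y *m C^T) =
    C *m reduced_vec P x X Y.
Proof.
move=> uA uB uM; rewrite /reduced_form /reduced_vec.
rewrite induced_form_act // induced_vec_act // !trmx_mul trmxK !mulmxA.
have BVB D : D *m B^T *m (invmx B)^T = D :> 'M_(m, 1 + m).
  by rewrite trmx_inv mulmxK // unitmx_tr.
by rewrite BVB mulmxKV.
Qed.

Hypothesis two_neq0 : 2%:R != 0 :> K.

Section Datum.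
Variables (P : 'M[K]_(1 + (1 + m))) (x : 'cV[K]_(1 + (1 + m))).
Variables (X : 'M[K]_(1 + (1 + m), 1 + m)) (Y : 'M[K]_(1 + m, m)).
Hypotheses (skP : P^T = - P) (uP : P \in unitmx) (uM : frame x X \in unitmx).
Let N := kernel_frame P x X Y.

Lemma reduced_form_skew : (reduced_form P x X Y)^T = - reduced_form P x X Y.
Proof.
rewrite /reduced_form trmx_mul [(Y^T *m _)^T]trmx_mul trmxK.
rewrite induced_form_skew //.
by rewrite mulNmx mulmxN mulmxA.
Qed.

Lemma kernel_frame_vec :
  N^T *m induced_vec P x X = col_mx 1%:M (reduced_vec P x X Y).
Proof.
rewrite /N /kernel_frame /frame tr_row_mx mul_col_mx; congr col_mx.
by rewrite -[LHS]trmxK trmx_mul trmxK induced_vec_kernel // trmx1.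
Qed.

(** S k = 0 leaves only the block between columns of Y. *)
Lemma kernel_frame_form :
  N^T *m induced_form P x X *m N = block_mx 0 0 0 (reduced_form P x X Y).
Proof.
have Sk := induced_form_kernel two_neq0 skP uM uP.
have kS : (kernel_vec P x X)^T *m induced_form P x X = 0.
  rewrite -[LHS]trmxK trmx_mul trmxK induced_form_skew // mulNmx Sk.
  by rewrite oppr0 trmx0.
rewrite /N /kernel_frame /frame tr_row_mx mul_col_mx mul_col_row kS !mul0mx.
by rewrite -mulmxA Sk mulmx0.
Qed.

(** A left inverse: modulo k, the coordinates along Y are recovered by S and
    the reduced form; then r recovers the coordinate along k. *)
Lemma kernel_frame_unit : reduced_form P x X Y \in unitmx -> N \in unitmx.
Proof.
move=> uR; set S := induced_form P x X; set r := induced_vec P x X.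
pose T := invmx (reduced_form P x X Y) *m Y^T *m S.
have Tk : T *m kernel_vec P x X = 0.
  by rewrite /T -mulmxA induced_form_kernel // mulmx0.
have TY : T *m Y = 1%:M.
  by rewrite /T -(mulmxA _ Y^T) -(mulmxA _ (Y^T *m S)); apply: mulVmx.
suff : col_mx (r^T - r^T *m Y *m T) T *m N = 1%:M by case/mulmx1_unit.
rewrite /N /kernel_frame /frame mul_col_row Tk TY !mulmxBl.
rewrite induced_vec_kernel // -!(mulmxA _ T) Tk TY mulmx0 mulmx1 subr0 subrr.
by rewrite -scalar_mx_block.
Qed.

End Datum.

End Reduction.

Section TransportMatrix.
Variable K : fieldType.

(** The matrix B with B N1 diag(1, C^T) = N2, which by frame_act is the only
    candidate for mapping the frame N1 to N2 when C acts on the next space. *)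
Definition transport_mx a (N1 N2 : 'M[K]_(1 + a)) (C : 'M[K]_a) : 'M_(1 + a) :=
  N2 *m invmx (ext_mx C^T) *m invmx N1.

Section TransportMatrixTheory.
Variables (a : nat) (N1 N2 : 'M[K]_(1 + a)) (C : 'M[K]_a).
Hypotheses (uN1 : N1 \in unitmx) (uC : C \in unitmx).

Lemma transport_mx_unit : N2 \in unitmx -> transport_mx N1 N2 C \in unitmx.
Proof.
by move=> uN2; rewrite !unitmx_mul !unitmx_inv ext_mx_unit unitmx_tr uN1 uN2 uC.
Qed.

Lemma transport_mxE : transport_mx N1 N2 C *m N1 *m ext_mx C^T = N2.
Proof. by rewrite /transport_mx !mulmxKV // ext_mx_unit unitmx_tr. Qed.

Lemma transport_mx_unique B : B *m N1 *m ext_mx C^T = N2 -> transport_mx N1 N2 C = B.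
Proof.
by move<-; rewrite /transport_mx !mulmxK // ext_mx_unit unitmx_tr.
Qed.

End TransportMatrixTheory.

Lemma transport_mx_frame a (x1 x2 : 'cV[K]_(1 + a)) (X1 X2 : 'M[K]_(1 + a, a)) C :
  frame x1 X1 \in unitmx -> C \in unitmx ->
  transport_mx (frame x1 X1) (frame x2 X2) C *m x1 = x2 /\
  transport_mx (frame x1 X1) (frame x2 X2) C *m X1 *m C^T = X2.
Proof.
move=> uN1 uC; apply: eq_row_mx.
by rewrite -/(frame _ _) frame_act transport_mxE.
Qed.

Hypothesis two_neq0 : 2%:R != 0 :> K.

(** Each kernel frame brings S and r into a normal form which involves only
    the reduced datum, and C matches the two normal forms. *)
Lemma transport_mx_induced m (P1 P2 : 'M[K]_(1 + (1 + m))) x1 x2 X1 X2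
    (Y1 Y2 : 'M[K]_(1 + m, m)) (C : 'M[K]_m) :
  P1^T = - P1 -> P2^T = - P2 -> P1 \in unitmx -> P2 \in unitmx ->
  frame x1 X1 \in unitmx -> frame x2 X2 \in unitmx ->
  C \in unitmx -> kernel_frame P1 x1 X1 Y1 \in unitmx ->
  C *m reduced_form P1 x1 X1 Y1 *m C^T = reduced_form P2 x2 X2 Y2 ->
  C *m reduced_vec P1 x1 X1 Y1 = reduced_vec P2 x2 X2 Y2 ->
  let B := transport_mx (kernel_frame P1 x1 X1 Y1) (kernel_frame P2 x2 X2 Y2) C in
  B^T *m induced_form P2 x2 X2 *m B = induced_form P1 x1 X1 /\
  B^T *m induced_vec P2 x2 X2 = induced_vec P1 x1 X1.
Proof.
move=> skP1 skP2 uP1 uP2 uM1 uM2 uC uN1 formC vecC B.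
set N1 := kernel_frame P1 x1 X1 Y1 in uN1 B *.
set N2 := kernel_frame P2 x2 X2 Y2 in B *.
pose D := ext_mx C; have DT : ext_mx C^T = D^T by rewrite ext_mx_tr.
have uD : D \in unitmx by rewrite ext_mx_unit.
have N2E : N2 = B *m N1 *m D^T by rewrite -DT transport_mxE.
have N2T : N2^T = D *m N1^T *m B^T.
  by rewrite N2E trmx_mul trmxK trmx_mul mulmxA.
have uDN : D *m N1^T \in unitmx by rewrite unitmx_mul uD unitmx_tr.
have form1 := kernel_frame_form two_neq0 Y1 skP1 uP1 uM1.
have form2 := kernel_frame_form two_neq0 Y2 skP2 uP2 uM2.
have vec1 := kernel_frame_vec two_neq0 Y1 skP1 uP1 uM1.
have vec2 := kernel_frame_vec two_neq0 Y2 skP2 uP2 uM2.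
set S1 := induced_form P1 x1 X1 in form1 *.
set S2 := induced_form P2 x2 X2 in form2 *.
set r1 := induced_vec P1 x1 X1 in vec1 *.
set r2 := induced_vec P2 x2 X2 in vec2 *.
rewrite -/N1 in form1 vec1; rewrite -/N2 in form2 vec2.
have uNDT : N1 *m D^T \in unitmx by rewrite unitmx_mul uN1 unitmx_tr.
split; apply: (can_inj (mulKmx uDN)); last first.
  rewrite mulmxA -N2T vec2 -vecC -[RHS]mulmxA vec1 /D /ext_mx mul_block_col.
  by rewrite mulmx1 !mul0mx addr0 add0r.
apply: (can_inj (mulmxK uNDT)).
transitivity (N2^T *m S2 *m N2); first by rewrite N2T {1}N2E !mulmxA.
transitivity (D *m (N1^T *m S1 *m N1) *m D^T); last by rewrite !mulmxA.
rewrite form1 form2 -formC -DT /D /ext_mx !mulmx_block.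
by rewrite !(mulmx0, mul0mx, addr0, add0r).
Qed.

Lemma transport_mx_form a (P1 P2 : 'M[K]_(1 + a)) x1 x2 X1 X2 (B : 'M[K]_a) :
  P1^T = - P1 -> P2^T = - P2 ->
  frame x1 X1 \in unitmx -> frame x2 X2 \in unitmx -> B \in unitmx ->
  B^T *m induced_form P2 x2 X2 *m B = induced_form P1 x1 X1 ->
  B^T *m induced_vec P2 x2 X2 = induced_vec P1 x1 X1 ->
  let A := transport_mx (frame x1 X1) (frame x2 X2) B in A *m P1 *m A^T = P2.
Proof.
move=> skP1 skP2 uM1 uM2 uB formB vecB A.
have [Ax AX] := transport_mx_frame x2 X2 uM1 uB; rewrite -/A in Ax AX.
clearbody A; rewrite [P1](form_of_induced two_neq0 skP1 uM1) -formB -vecB.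
have xT : x1^T *m A^T = x2^T by rewrite -trmx_mul Ax.
have XT : B *m X1^T *m A^T = X2^T by rewrite -AX !trmx_mul trmxK mulmxA.
rewrite [RHS](form_of_induced two_neq0 skP2 uM2).
move: (induced_form _ _ _) (induced_vec _ _ _) => S r.
rewrite -XT -AX -xT -Ax.
by rewrite trmx_mul trmxK !(mulmxDr, mulmxDl, mulmxN, mulNmx) !mulmxA.
Qed.

End TransportMatrix.

(** * The element carrying one generic datum to another *)

Section Transporter.
Variable K : closedFieldType.

(** Genericity of the reduced datum contains the invertibility of its
    bivector, hence that of the kernel frame. *)
Fixpoint generic (n : nat) :
    'M[K]_n.*2 -> 'cV[K]_n.*2 -> E_tower K n.*2 -> bool :=
  match n with
  | 0 => fun _ _ _ => true
  | n'.+1 => fun (P : 'M[K]_(1 + (1 + n'.*2))) (x : 'cV[K]_(1 + (1 + n'.*2)))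
      (E : 'M[K]_(1 + (1 + n'.*2), 1 + n'.*2) *
           ('M[K]_(1 + n'.*2, n'.*2) * E_tower K n'.*2)) =>
      [&& P \in unitmx, frame x E.1 \in unitmx
        & generic (reduced_form P x E.1 E.2.1) (reduced_vec P x E.1 E.2.1) E.2.2]
  end.

(** The tail C comes from the reduced data; the kernel frames then determine
    B, and the frames determine A. *)
Fixpoint transporter (n : nat) :
    'M[K]_n.*2 -> 'cV[K]_n.*2 -> E_tower K n.*2 ->
    'M[K]_n.*2 -> 'cV[K]_n.*2 -> E_tower K n.*2 -> sq_tower K n.*2 :=
  match n with
  | 0 => fun _ _ _ _ _ _ => 1%:M
  | n'.+1 => fun (P1 : 'M[K]_(1 + (1 + n'.*2))) (x1 : 'cV[K]_(1 + (1 + n'.*2)))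
      (E1 : 'M[K]_(1 + (1 + n'.*2), 1 + n'.*2) *
           ('M[K]_(1 + n'.*2, n'.*2) * E_tower K n'.*2))
      (P2 : 'M[K]_(1 + (1 + n'.*2))) (x2 : 'cV[K]_(1 + (1 + n'.*2)))
      (E2 : 'M[K]_(1 + (1 + n'.*2), 1 + n'.*2) *
           ('M[K]_(1 + n'.*2, n'.*2) * E_tower K n'.*2)) =>
    let C := transporter
      (reduced_form P1 x1 E1.1 E1.2.1) (reduced_vec P1 x1 E1.1 E1.2.1) E1.2.2
      (reduced_form P2 x2 E2.1 E2.2.1) (reduced_vec P2 x2 E2.1 E2.2.1) E2.2.2 in
    let B := transport_mx (kernel_frame P1 x1 E1.1 E1.2.1)
                  (kernel_frame P2 x2 E2.1 E2.2.1) (top_mx C) in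
    (transport_mx (frame x1 E1.1) (frame x2 E2.1) B, (B, C))
  end.

Lemma genericS n P x X Y E : @generic n.+1 P x (X, (Y, E)) =
  [&& P \in unitmx, frame (x : 'cV_(1 + (1 + n.*2))) X \in unitmx
    & generic (reduced_form P x X Y) (reduced_vec P x X Y) E].
Proof. by []. Qed.

Lemma transporterS n P1 x1 X1 Y1 E1 P2 x2 X2 Y2 E2 :
  @transporter n.+1 P1 x1 (X1, (Y1, E1)) P2 x2 (X2, (Y2, E2)) =
  let C := @transporter n
    (reduced_form P1 x1 X1 Y1) (reduced_vec P1 x1 X1 Y1) E1
    (reduced_form P2 x2 X2 Y2) (reduced_vec P2 x2 X2 Y2) E2 in
  let B := transport_mx (kernel_frame P1 x1 X1 Y1)
                (kernel_frame P2 x2 X2 Y2) (top_mx C) in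
  (transport_mx (frame x1 X1) (frame x2 X2) B, (B, C)).
Proof. by []. Qed.

Arguments generic : simpl never.
Arguments transporter : simpl never.

Lemma generic_unit n P x E : @generic n P x E -> P \in unitmx.
Proof.
by case: n P x E => [|n] P x E; [rewrite unitmxE det_mx00 unitr1|case/and3P].
Qed.

Lemma GL_tower_top m (A : sq_tower K m) : GL_tower A -> top_mx A \in unitmx.
Proof. by case: m A => [|m] A; [rewrite unitmxE det_mx00 unitr1|case]. Qed.

Definition transports n (P1 : 'M[K]_n.*2) (x1 : 'cV[K]_n.*2)
    (E1 : E_tower K n.*2) (P2 : 'M[K]_n.*2) (x2 : 'cV[K]_n.*2)
    (E2 : E_tower K n.*2) (g : sq_tower K n.*2) :=
  [/\ GL_tower g, top_mx g *m P1 *m (top_mx g)^T = P2, top_mx g *m x1 = x2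
    & E_act g E1 = E2].

Hypothesis two_neq0 : 2%:R != 0 :> K.

Section Step.
Variable n : nat.
Variables (P1 P2 A : 'M[K]_(1 + (1 + n.*2))) (x1 x2 : 'cV[K]_(1 + (1 + n.*2))).
Variables (X1 X2 : 'M[K]_(1 + (1 + n.*2), 1 + n.*2)).
Variables (B : 'M[K]_(1 + n.*2)) (Y1 Y2 : 'M[K]_(1 + n.*2, n.*2)).
Variables (C : sq_tower K n.*2) (E1 E2 : E_tower K n.*2).

Lemma transportsS :
  @transports n.+1 P1 x1 (X1, (Y1, E1)) P2 x2 (X2, (Y2, E2)) (A, (B, C)) <->
  [/\ [/\ A \in unitmx, B \in unitmx & GL_tower C], A *m P1 *m A^T = P2,
      A *m x1 = x2, A *m X1 *m B^T = X2
    & B *m Y1 *m (top_mx C)^T = Y2 /\ E_act C E1 = E2].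
Proof.
split=> [[[uA [uB GLC]] AP Ax [AX BY CE]] //|].
by move=> [[uA uB GLC] AP Ax AX [BY CE]]; split=> //; congr (_, (_, _)).
Qed.

(** Two frames match by construction of B and A.  That A also matches the
    bivectors follows from their blocks, which B matches. *)
Lemma transporter_step :
  P1^T = - P1 -> P2^T = - P2 ->
  @generic n.+1 P1 x1 (X1, (Y1, E1)) -> @generic n.+1 P2 x2 (X2, (Y2, E2)) ->
  transports (reduced_form P1 x1 X1 Y1) (reduced_vec P1 x1 X1 Y1) E1
    (reduced_form P2 x2 X2 Y2) (reduced_vec P2 x2 X2 Y2) E2 C ->
  let B' := transport_mx (kernel_frame P1 x1 X1 Y1)
                (kernel_frame P2 x2 X2 Y2) (top_mx C) in
  let A' := transport_mx (frame x1 X1) (frame x2 X2) B' in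
  @transports n.+1 P1 x1 (X1, (Y1, E1)) P2 x2 (X2, (Y2, E2)) (A', (B', C)).
Proof.
move=> skP1 skP2; rewrite !genericS => /and3P[uP1 uM1 gen1] /and3P[uP2 uM2 gen2].
move=> [GLC formC vecC actC] B' A'.
have uN1 := kernel_frame_unit two_neq0 skP1 uP1 uM1 (generic_unit gen1).
have uN2 := kernel_frame_unit two_neq0 skP2 uP2 uM2 (generic_unit gen2).
have uC := GL_tower_top GLC.
have uB : B' \in unitmx by apply: transport_mx_unit.
have [_ BY] := transport_mx_frame (kernel_vec P2 x2 X2) Y2 uN1 uC.
have [Ax AX] := transport_mx_frame x2 X2 uM1 uB.
have [formB vecB] := transport_mx_induced two_neq0 skP1 skP2 uP1 uP2 uM1 uM2
  uC uN1 formC vecC.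
split=> //; first by split; [apply: transport_mx_unit|split].
  exact: transport_mx_form.
by congr (_, (_, _)).
Qed.

(** By equivariance of the reduction the tail C transports the reduced data,
    and B and A transport the frames, which leaves no choice for them. *)
Lemma transporter_unique_step :
  P1^T = - P1 -> @generic n.+1 P1 x1 (X1, (Y1, E1)) ->
  @transports n.+1 P1 x1 (X1, (Y1, E1)) P2 x2 (X2, (Y2, E2)) (A, (B, C)) ->
  [/\ P2 \in unitmx, frame x2 X2 \in unitmx,
      transports (reduced_form P1 x1 X1 Y1) (reduced_vec P1 x1 X1 Y1) E1
        (reduced_form P2 x2 X2 Y2) (reduced_vec P2 x2 X2 Y2) E2 C,
      transport_mx (kernel_frame P1 x1 X1 Y1) (kernel_frame P2 x2 X2 Y2)
        (top_mx C) = B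
    & transport_mx (frame x1 X1) (frame x2 X2) B = A].
Proof.
move=> skP1; rewrite !genericS => /and3P[uP1 uM1 gen1] /transportsS.
move=> [[uA uB GLC] <- <- <- [<- <-]]; have uC := GL_tower_top GLC.
have uN1 := kernel_frame_unit two_neq0 skP1 uP1 uM1 (generic_unit gen1).
have [form2 vec2] := reduced_act (top_mx C) P1 Y1 uA uB uM1.
have [uM2 _ _] := coframe_act uA uB uM1.
split=> //.
- by rewrite !unitmx_mul unitmx_tr uA uP1.
- apply: transport_mx_unique => //.
  by rewrite /kernel_frame kernel_vec_act // frame_act.
- by apply: transport_mx_unique => //; rewrite frame_act.
Qed.

End Step.

Lemma transporterP n P1 x1 E1 P2 x2 E2 :
  P1^T = - P1 -> P2^T = - P2 -> @generic n P1 x1 E1 -> @generic n P2 x2 E2 ->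
  transports P1 x1 E1 P2 x2 E2 (transporter P1 x1 E1 P2 x2 E2).
Proof.
elim: n P1 x1 E1 P2 x2 E2 => [|n IHn] P1 x1 E1 P2 x2 E2 skP1 skP2.
  by move=> _ _; split; rewrite ?[LHS]flatmx0 ?[RHS]flatmx0.
case: E1 E2 => X1 [Y1 E1] [X2 [Y2 E2]] gen1 gen2.
apply: transporter_step => //; apply: IHn.
- exact: reduced_form_skew.
- exact: reduced_form_skew.
- by case/and3P: gen1.
- by case/and3P: gen2.
Qed.

Lemma transporter_unique n P1 x1 E1 P2 x2 E2 g :
  P1^T = - P1 -> @generic n P1 x1 E1 -> transports P1 x1 E1 P2 x2 E2 g ->
  generic P2 x2 E2 /\ transporter P1 x1 E1 P2 x2 E2 = g.
Proof.
elim: n P1 x1 E1 P2 x2 E2 g => [|n IHn] P1 x1 E1 P2 x2 E2 g skP1.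
  by move=> _ _; split; rewrite // [LHS]flatmx0 [RHS]flatmx0.
case: E1 E2 g => X1 [Y1 E1] [X2 [Y2 E2]] [A [B C]] gen1 tr.
have [uP2 uM2 trC BE AE] := transporter_unique_step skP1 gen1 tr.
have [||gen2 CE] := IHn _ _ _ _ _ _ _ _ _ trC.
- exact: reduced_form_skew.
- by case/and3P: gen1.
rewrite genericS; split; first exact/and3P.
by rewrite transporterS; cbv zeta; rewrite CE BE AE.
Qed.

End Transporter.

(** * A generic vector for the standard symplectic form *)

Section BasePoint.
Variable K : closedFieldType.

(** The first hyperbolic plane is written in 1 + (1 + m) block form, the shape
    in which the reduction acts. *)
Lemma omega_mxS n : omega_mx K n.+1 =
  block_mx 0 (row_mx 1%:M 0) (col_mx (- 1%:M) 0)
    (block_mx 0 0 0 (omega_mx K n)) :> 'M_(1 + (1 + n.*2)).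
Proof.
apply/matrixP => i j; case: (split_ordP i) => [i' ->|i' ->];
case: (split_ordP j) => [j' ->|j' ->];
rewrite ?(block_mxEul, block_mxEur, block_mxEdl, block_mxEdr).
- by rewrite !ord1 !mxE.
- rewrite ord1; case: (split_ordP j') => [k ->|k ->];
  rewrite ?row_mxEl ?row_mxEr.
    by rewrite !ord1 !mxE.
  by rewrite !mxE /= andbF.
- rewrite !ord1; case: (split_ordP i') => [k ->|k ->];
  rewrite ?col_mxEu ?col_mxEd.
    by rewrite !ord1 !mxE.
  by rewrite !mxE /= ?andbF.
case: (split_ordP i') => [k ->|k ->]; case: (split_ordP j') => [l ->|l ->];
rewrite ?(block_mxEul, block_mxEur, block_mxEdl, block_mxEdr).
- by rewrite !ord1 !mxE.
- by rewrite !ord1 !mxE /= ?andbF.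
- by rewrite !ord1 !mxE /= ?andbF.
by rewrite !mxE /= !negbK !eqSS.
Qed.

Lemma omega_mx_skew n : (omega_mx K n)^T = - omega_mx K n.
Proof.
apply/matrixP => i j; rewrite !mxE.
have [/andP[ei /eqP ij]|ni] := boolP (~~ odd i && _).
  have -> : ~~ odd j && (i == j.+1 :> nat) = false.
    by rewrite ij /= ei andbC ltn_eqF.
  by [].
by case: ifP => _; rewrite ?opprK ?oppr0.
Qed.

Lemma omega_mx_sqr n : omega_mx K n *m omega_mx K n = - 1%:M.
Proof.
elim: n => [|n IHn]; first by rewrite [LHS]flatmx0 [RHS]flatmx0.
pose J : 'M[K]_(1 + (1 + n.*2)) := block_mx 0 (row_mx 1%:M 0)
  (col_mx (- 1%:M) 0) (block_mx 0 0 0 (omega_mx K n)).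
suff JJ : J *m J = - 1%:M by rewrite omega_mxS.
rewrite mulmx_block !mul_row_col mul_col_row mul_col_mx mul_mx_row.
rewrite mul_block_col mulmx_block IHn.
rewrite !(mul0mx, mulmx0, mul1mx, mulmx1, addr0, add0r).
rewrite !(row_mx0, col_mx0, addr0, add0r) add_block_mx !(addr0, add0r).
rewrite [in RHS](@scalar_mx_block _ 1 (1 + n.*2)) (@scalar_mx_block _ 1 n.*2).
by rewrite !opp_block_mx !oppr0.
Qed.

Lemma omega_mx_unit n : omega_mx K n \in unitmx.
Proof.
have : omega_mx K n *m - omega_mx K n = 1%:M by rewrite mulmxN omega_mx_sqr opprK.
by case/mulmx1_unit.
Qed.

(** A generic vector y of the smaller space is lifted by choosing the frame
    unipotent, with y as its only entry off the diagonal.  The inverse frame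
    then has - y there, and the sign of the hyperbolic plane turns this into
    the reduced vector y. *)
Lemma generic_omega n : exists x E, @generic K n (omega_mx K n) x E.
Proof.
elim: n => [|n [y [E genE]]]; first by exists 0, 0.
pose l : 'rV[K]_(1 + (1 + n.*2)) := row_mx 1%:M 0.
pose Q' : 'M[K]_(1 + n.*2) := block_mx 1%:M 0 (- y) 1%:M.
pose Q : 'M[K]_(1 + n.*2, 1 + (1 + n.*2)) := row_mx 0 Q'.
pose X' : 'M[K]_(1 + n.*2) := block_mx 1%:M 0 y 1%:M.
pose x : 'cV[K]_(1 + (1 + n.*2)) := col_mx 1%:M 0.
pose X : 'M[K]_(1 + (1 + n.*2), 1 + n.*2) := col_mx 0 X'.
pose Y : 'M[K]_(1 + n.*2, n.*2) := col_mx 0 1%:M.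
exists x, (X, (Y, E)); rewrite genericS omega_mx_unit /=.
have QX' : Q' *m X' = 1%:M.
  rewrite /Q' /X' mulmx_block !(mul0mx, mulmx0, mul1mx, mulmx1, addr0, add0r).
  by rewrite addNr -scalar_mx_block.
have [|||| uM lE QE] := @coframe_unique _ _ x X l Q.
- by rewrite mul_row_col mul0mx addr0 mulmx1.
- by rewrite mul_row_col mul0mx addr0 mulmx0.
- by rewrite mul_row_col mul0mx add0r mulmx0.
- by rewrite mul_row_col mul0mx add0r QX'.
rewrite uM /=.
have YQ : Y^T *m Q = row_mx 0 (row_mx (- y) 1%:M).
  rewrite mul_mx_row mulmx0; congr row_mx.
  rewrite tr_col_mx trmx0 trmx1 mul_row_block.
  by rewrite !(mul0mx, mulmx0, mul1mx, mulmx1, addr0, add0r).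
pose J : 'M[K]_(1 + (1 + n.*2)) := block_mx 0 (row_mx 1%:M 0)
  (col_mx (- 1%:M) 0) (block_mx 0 0 0 (omega_mx K n)).
have YQP : Y^T *m Q *m J = row_mx y (row_mx 0 (omega_mx K n)).
  rewrite YQ mul_row_block mul_row_col mul_row_block.
  by rewrite !(mul0mx, mulmx0, mul1mx, mulmx1, addr0, add0r) mulmxN mulmx1 opprK.
rewrite omega_mxS -/J.
have -> : reduced_vec (J) x X Y = y.
  rewrite /reduced_vec /induced_vec QE lE !mulmxA YQP tr_row_mx mul_row_col.
  by rewrite trmx0 trmx1 mulmx0 mulmx1 addr0.
have -> : reduced_form (J) x X Y = omega_mx K n.
  rewrite /reduced_form /induced_form QE !mulmxA YQP -mulmxA -[_ *m Y]trmxK.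
  rewrite trmx_mul trmxK YQ tr_row_mx mul_row_col tr_row_mx mul_row_col.
  by rewrite !(trmx0, trmx1, mul0mx, mulmx0, mulmx1, add0r).
by [].
Qed.

End BasePoint.

(** * Regularity of matrix operations *)

Section RegularMatrices.
Variables (K : closedFieldType) (W : vectType K) (S : set W).

Lemma regular_scalar_comp (V : vectType K) (L : V -> K) (f : W -> V) :
  scalar L -> regular_map S f -> regular_fun S (L \o f).
Proof.
move=> linL /regular_mapP rf.
pose L' : {scalar V} := HB.pack L (GRing.isLinear.Build K V K *%R L linL).
exact: rf L'.
Qed.

Lemma regular_linear_comp (V V' : vectType K) (h : V -> V') (f : W -> V) :
  linear h -> regular_map S f -> regular_map S (h \o f).
Proof.
move=> linh rf; apply/regular_mapP => L.
apply: (@regular_scalar_comp _ (L \o h)) => // a u v /=.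
by rewrite linh linearP.
Qed.

Lemma regular_map_id : regular_map S (@id W).
Proof. by apply/regular_mapP => L; apply: regular_scalar. Qed.

Lemma regular_map_cst (V : vectType K) (v : V) : regular_map S (fun=> v).
Proof. by move=> i; apply: regular_cst. Qed.

Lemma regular_pair (V V' : vectType K) (f : W -> V) (g : W -> V') :
  regular_map S f -> regular_map S g ->
  regular_map S (fun w => (f w, g w) : (V * V')%type).
Proof.
move=> rf rg; apply/regular_mapP => L.
apply: (@regular_ext _ _ _ (fun w => L (f w, 0) + L (0, g w))).
  move=> w _; rewrite -linearD /=; congr (L _).
  by apply/pair_eqP; rewrite /= addr0 add0r !eqxx.
apply: regularD.
  apply: (@regular_scalar_comp _ (fun v => L (v, 0))) => // a u v.
  rewrite -linearP; congr (L _).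
  by apply/pair_eqP; rewrite /= scaler0 addr0 !eqxx.
apply: (@regular_scalar_comp _ (fun v => L (0, v))) => // a u v.
rewrite -linearP; congr (L _).
by apply/pair_eqP; rewrite /= scaler0 addr0 !eqxx.
Qed.

Lemma regular_fst (V V' : vectType K) (f : W -> (V * V')%type) :
  regular_map S f -> regular_map S (fun w => (f w).1).
Proof. exact: (@regular_linear_comp _ _ fst). Qed.

Lemma regular_snd (V V' : vectType K) (f : W -> (V * V')%type) :
  regular_map S f -> regular_map S (fun w => (f w).2).
Proof. exact: (@regular_linear_comp _ _ snd). Qed.

Lemma regular_entry p q (f : W -> 'M[K]_(p, q)) i j :
  regular_map S f -> regular_fun S (fun w => f w i j).
Proof.
by apply: (@regular_scalar_comp _ (fun A : 'M_(p, q) => A i j)) => a u v;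
  rewrite !mxE.
Qed.

Lemma regular_entries p q (f : W -> 'M[K]_(p, q)) :
  (forall i j, regular_fun S (fun w => f w i j)) -> regular_map S f.
Proof.
move=> rf; apply/regular_mapP => L.
apply: (@regular_ext _ _ _ (fun w =>
    \sum_i \sum_j f w i j * L (delta_mx i j))).
  move=> w _ /=; rewrite [in RHS](matrix_sum_delta (f w)) linear_sum.
  apply: eq_bigr => i _; rewrite linear_sum.
  by apply: eq_bigr => j _; rewrite linearZ.
apply: regular_sum => i; apply: regular_sum => j.
by apply: regularM => //; apply: regular_cst.
Qed.

Lemma regular_mulmx p q r (f : W -> 'M[K]_(p, q)) (g : W -> 'M[K]_(q, r)) :
  regular_map S f -> regular_map S g -> regular_map S (fun w => f w *m g w).
Proof.
move=> rf rg; apply: regular_entries => i k.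
apply: (@regular_ext _ _ _ (fun w => \sum_j f w i j * g w j k)).
  by move=> w _; rewrite mxE.
by apply: regular_sum => j; apply: regularM; apply: regular_entry.
Qed.

Lemma regular_trmx p q (f : W -> 'M[K]_(p, q)) :
  regular_map S f -> regular_map S (fun w => (f w)^T).
Proof. by apply: (@regular_linear_comp _ _ trmx) => a u v; rewrite linearP. Qed.

Lemma regular_oppmx p q (f : W -> 'M[K]_(p, q)) :
  regular_map S f -> regular_map S (fun w => - f w).
Proof. by apply: (@regular_linear_comp _ _ -%R) => a u v; rewrite linearP. Qed.

Lemma regular_usubmx p1 p2 q (f : W -> 'M[K]_(p1 + p2, q)) :
  regular_map S f -> regular_map S (fun w => usubmx (f w)).
Proof. by apply: (@regular_linear_comp _ _ usubmx) => a u v; rewrite linearP. Qed.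

Lemma regular_dsubmx p1 p2 q (f : W -> 'M[K]_(p1 + p2, q)) :
  regular_map S f -> regular_map S (fun w => dsubmx (f w)).
Proof. by apply: (@regular_linear_comp _ _ dsubmx) => a u v; rewrite linearP. Qed.

Lemma regular_row_mx p q1 q2 (f : W -> 'M[K]_(p, q1)) (g : W -> 'M[K]_(p, q2)) :
  regular_map S f -> regular_map S g ->
  regular_map S (fun w => row_mx (f w) (g w)).
Proof.
move=> rf rg; apply: regular_entries => i j.
case: (split_ordP j) => k ->.
  apply: (@regular_ext _ _ _ (fun w => f w i k)); last exact: regular_entry.
  by move=> w _; rewrite row_mxEl.
apply: (@regular_ext _ _ _ (fun w => g w i k)); last exact: regular_entry.
by move=> w _; rewrite row_mxEr.
Qed.

Lemma regular_col_mx p1 p2 q (f : W -> 'M[K]_(p1, q)) (g : W -> 'M[K]_(p2, q)) :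
  regular_map S f -> regular_map S g ->
  regular_map S (fun w => col_mx (f w) (g w)).
Proof.
move=> rf rg; apply: (@regular_map_ext _ _ _ _ (fun w =>
  (row_mx (f w)^T (g w)^T)^T)).
  by move=> w _; rewrite tr_row_mx !trmxK.
by apply/regular_trmx/regular_row_mx; apply: regular_trmx.
Qed.

Lemma regular_ext_mx a (f : W -> 'M[K]_a) :
  regular_map S f -> regular_map S (fun w => ext_mx (f w)).
Proof.
move=> rf; apply: regular_col_mx; first exact: regular_map_cst.
by apply: regular_row_mx => //; apply: regular_map_cst.
Qed.

Lemma regular_det p (f : W -> 'M[K]_p) :
  regular_map S f -> regular_fun S (fun w => \det (f w)).
Proof.
move=> rf; apply: regular_sum => s; apply: regularM; first exact: regular_cst.
by apply: regular_prod => i; apply: regular_entry.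
Qed.

Lemma regular_invmx p (f : W -> 'M[K]_p) :
  (forall w, S w -> f w \in unitmx) -> regular_map S f ->
  regular_map S (fun w => invmx (f w)).
Proof.
move=> uf rf; apply: regular_entries => i j.
pose minor w := row' j (col' i (f w)).
apply: (@regular_ext _ _ _ (fun w =>
  (\det (f w))^-1 * ((-1) ^+ (j + i) * \det (minor w)))).
  by move=> w Sw; rewrite /invmx uf // !mxE.
apply: regularM.
  by apply: regularV (regular_det rf) => w Sw; rewrite -unitfE -unitmxE uf.
apply: regularM; first exact: regular_cst.
apply/regular_det/regular_entries => k l.
apply: (@regular_ext _ _ _ (fun w => f w (lift j k) (lift i l))).
  by move=> w _; rewrite !mxE.
exact: regular_entry.
Qed.

(** An endomorphism is determined linearly by the images of a basis: it is the
    sum of the rank one maps built from them. *)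
Lemma regular_linfun (V : vectType K) (f : W -> V -> V) :
  (forall w, linear (f w)) -> (forall v, regular_map S (fun w => f w v)) ->
  regular_map S (fun w => linfun (f w) : 'End(V)).
Proof.
move=> linf rf; pose b := vbasis {:V}.
have linfunE (h : V -> V) (v : V) : linear h -> linfun h v = h v.
  move=> linh.
  pose h' : {linear V -> V} :=
    HB.pack h (GRing.isLinear.Build K V V *:%R h linh).
  exact: (lfunE h').
pose rank_one i v : 'End(V) := linfun (fun u => coord b i u *: v).
have rank_oneE i v u : rank_one i v u = coord b i u *: v.
  by apply: linfunE => a u1 u2; rewrite linearP scalerDl scalerA.
apply/regular_mapP => L; apply: (@regular_ext _ _ _ (fun w =>
  \sum_(i < \dim {:V}) L (rank_one i (f w b`_i)))).
  move=> w _ /=; rewrite -linear_sum; congr (L _); apply/lfunP => u.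
  rewrite sum_lfunE linfunE // [in RHS](coord_vbasis (memvf u)).
  pose fw : {linear V -> V} := HB.pack (f w)
    (GRing.isLinear.Build K V V *:%R (f w) (linf w)).
  rewrite -[RHS]/(fw _) linear_sum; apply: eq_bigr => i _.
  by rewrite rank_oneE linearZ.
apply: regular_sum => i.
apply: (@regular_scalar_comp _ (fun v => L (rank_one i v))) => // a u v.
rewrite -linearP; congr (L _); apply/lfunP => y.
by rewrite add_lfunE scale_lfunE !rank_oneE scalerDr !scalerA mulrC.
Qed.

End RegularMatrices.

(** * Regularity of the transporter and openness of genericity *)

Section RegularFrames.
Variables (K : closedFieldType) (W : vectType K).

Section Step.
Variables (S : set W) (a : nat).
Variables (P : W -> 'M[K]_(1 + a)) (x : W -> 'cV[K]_(1 + a)).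
Variable (X : W -> 'M[K]_(1 + a, a)).
Hypotheses (rP : regular_map S P) (rx : regular_map S x).
Hypothesis rX : regular_map S X.

Lemma regular_frame : regular_map S (fun w => frame (x w) (X w)).
Proof. exact: regular_row_mx. Qed.

Lemma regular_kernel_vec : (forall w, S w -> P w \in unitmx) ->
  regular_map S (fun w => kernel_vec (P w) (x w) (X w)).
Proof.
move=> uP; apply/regular_oppmx/regular_mulmx => //; apply: regular_mulmx.
  exact: regular_trmx.
exact: regular_invmx.
Qed.

Hypothesis uM : forall w, S w -> frame (x w) (X w) \in unitmx.

Lemma regular_coframe :
  regular_map S (fun w => coframe_vec (x w) (X w)) /\
  regular_map S (fun w => coframe_proj (x w) (X w)).
Proof.
have rV := regular_invmx uM regular_frame.
by split; [apply: regular_usubmx|apply: regular_dsubmx].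
Qed.

Lemma regular_induced :
  regular_map S (fun w => induced_form (P w) (x w) (X w)) /\
  regular_map S (fun w => induced_vec (P w) (x w) (X w)).
Proof.
have [rl rQ] := regular_coframe.
by split; apply: regular_mulmx; do ?apply: regular_trmx => //;
  apply: regular_mulmx.
Qed.

End Step.

Lemma regular_reduced (S : set W) m (P : W -> 'M[K]_(1 + (1 + m)))
    (x : W -> 'cV[K]_(1 + (1 + m))) (X : W -> 'M[K]_(1 + (1 + m), 1 + m))
    (Y : W -> 'M[K]_(1 + m, m)) :
  regular_map S P -> regular_map S x -> regular_map S X -> regular_map S Y ->
  (forall w, S w -> frame (x w) (X w) \in unitmx) ->
  regular_map S (fun w => reduced_form (P w) (x w) (X w) (Y w)) /\
  regular_map S (fun w => reduced_vec (P w) (x w) (X w) (Y w)).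
Proof.
move=> rP rx rX rY uM; have [rS rr] := regular_induced rP rx rX uM.
have rYT := regular_trmx rY.
by split; apply: regular_mulmx => //; apply: regular_mulmx.
Qed.

Lemma regular_transport_mx (S : set W) a (N1 N2 : W -> 'M[K]_(1 + a))
    (C : W -> 'M[K]_a) :
  regular_map S N1 -> regular_map S N2 -> regular_map S C ->
  (forall w, S w -> N1 w \in unitmx) -> (forall w, S w -> C w \in unitmx) ->
  regular_map S (fun w => transport_mx (N1 w) (N2 w) (C w)).
Proof.
move=> r1 r2 rC u1 uC; apply: regular_mulmx; last exact: regular_invmx.
apply: regular_mulmx => //; apply: regular_invmx.
  by move=> w Sw; rewrite ext_mx_unit unitmx_tr uC.
exact/regular_ext_mx/regular_trmx.
Qed.

Lemma regular_top_mx (S : set W) m (f : W -> sq_tower K m) :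
  regular_map S f -> regular_map S (fun w => top_mx (f w)).
Proof. by case: m f => [|m] f //; apply: regular_fst. Qed.

Lemma open_unitmx (S : set W) p (f : W -> 'M[K]_p) :
  zariski_open S -> regular_map S f ->
  zariski_open (S `&` [set w | f w \in unitmx]).
Proof.
move=> So /regular_det/(zariski_open_nonzero So).
congr (zariski_open (_ `&` _)); apply/seteqP.
by split=> w /=; rewrite unitmxE unitfE.
Qed.

Lemma regular_map_subset (V : vectType K) (S T : set W) (f : W -> V) :
  S `<=` T -> regular_map T f -> regular_map S f.
Proof. by move=> ST rf i; apply: regular_subset (rf i). Qed.

Lemma open_GL_tower (S : set W) m (f : W -> sq_tower K m) :
  zariski_open S -> regular_map S f ->
  zariski_open (S `&` [set w | GL_tower (f w)]).
Proof.
elim: m f S => [|m IHm] f S So rf /=; first by rewrite setIT.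
have := IHm (fun w => (f w).2) _ (open_unitmx So (regular_fst rf)).
rewrite -setIA; apply; apply: regular_map_subset (regular_snd rf).
by move=> w [].
Qed.

Lemma open_generic n (S : set W) (P : W -> 'M[K]_n.*2) (x : W -> 'cV[K]_n.*2)
    (E : W -> E_tower K n.*2) :
  zariski_open S -> regular_map S P -> regular_map S x -> regular_map S E ->
  zariski_open (S `&` [set w | generic (P w) (x w) (E w)]).
Proof.
elim: n S P x E => [|n IHn] S P x E So rP rx rE.
  suff -> : [set w | generic (P w) (x w) (E w)] = setT by rewrite setIT.
  by apply/seteqP.
pose X w : 'M[K]_(1 + (1 + n.*2), 1 + n.*2) := (E w).1.
pose Y w : 'M[K]_(1 + n.*2, n.*2) := (E w).2.1.
pose P' w : 'M[K]_(1 + (1 + n.*2)) := P w.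
pose x' w : 'cV[K]_(1 + (1 + n.*2)) := x w.
have rX : regular_map S X by apply: regular_fst rE.
have rY : regular_map S Y by apply/regular_fst/(regular_snd rE).
have rE' : regular_map S (fun w => (E w).2.2).
  by apply/regular_snd/(regular_snd rE).
have S1o := open_unitmx So rP; set S1 := S `&` _ in S1o.
have sub1 : S1 `<=` S by move=> w [].
have rM : regular_map S1 (fun w => frame (x' w) (X w)).
  by apply: regular_map_subset sub1 _; apply: regular_frame.
have S2o := open_unitmx S1o rM; set S2 := S1 `&` _ in S2o.
have sub2 : S2 `<=` S by move=> w [[]].
have restr (V : vectType K) (f : W -> V) : regular_map S f -> regular_map S2 f.
  exact: regular_map_subset.
have [|rform rvec] := regular_reduced (restr _ _ (rP : regular_map S P'))
  (restr _ _ (rx : regular_map S x')) (restr _ _ rX) (restr _ _ rY).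
  by move=> w [].
have := IHn _ _ _ _ S2o rform rvec (restr _ _ rE').
congr zariski_open; apply/seteqP; split=> w.
  by move=> [[[Sw uP] uM] gen]; split=> //; apply/and3P.
by move=> [Sw /and3P[uP uM gen]].
Qed.

Hypothesis two_neq0 : 2%:R != 0 :> K.

Lemma regular_transporter n (S : set W)
    (P1 : W -> 'M[K]_n.*2) (x1 : W -> 'cV[K]_n.*2) (E1 : W -> E_tower K n.*2)
    (P2 : W -> 'M[K]_n.*2) (x2 : W -> 'cV[K]_n.*2) (E2 : W -> E_tower K n.*2) :
  regular_map S P1 -> regular_map S x1 -> regular_map S E1 ->
  regular_map S P2 -> regular_map S x2 -> regular_map S E2 ->
  (forall w, S w -> (P1 w)^T = - P1 w) -> (forall w, S w -> (P2 w)^T = - P2 w) ->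
  (forall w, S w -> generic (P1 w) (x1 w) (E1 w)) ->
  (forall w, S w -> generic (P2 w) (x2 w) (E2 w)) ->
  regular_map S (fun w => transporter (P1 w) (x1 w) (E1 w) (P2 w) (x2 w) (E2 w)).
Proof.
elim: n P1 x1 E1 P2 x2 E2 => [|n IHn] P1 x1 E1 P2 x2 E2.
  by move=> *; apply: regular_map_cst.
pose T := 'M[K]_(1 + (1 + n.*2)); pose cT := 'cV[K]_(1 + (1 + n.*2)).
pose X1 w : 'M[K]_(1 + (1 + n.*2), 1 + n.*2) := (E1 w).1.
pose X2 w : 'M[K]_(1 + (1 + n.*2), 1 + n.*2) := (E2 w).1.
pose Y1 w : 'M[K]_(1 + n.*2, n.*2) := (E1 w).2.1.
pose Y2 w : 'M[K]_(1 + n.*2, n.*2) := (E2 w).2.1.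
pose P1' w : T := P1 w; pose P2' w : T := P2 w.
pose x1' w : cT := x1 w; pose x2' w : cT := x2 w.
move=> rP1 rx1 rE1 rP2 rx2 rE2 skP1 skP2 gen1 gen2.
have rX1 : regular_map S X1 by apply: regular_fst rE1.
have rX2 : regular_map S X2 by apply: regular_fst rE2.
have rY1 : regular_map S Y1 by apply/regular_fst/(regular_snd rE1).
have rY2 : regular_map S Y2 by apply/regular_fst/(regular_snd rE2).
have rE1' : regular_map S (fun w => (E1 w).2.2).
  by apply/regular_snd/(regular_snd rE1).
have rE2' : regular_map S (fun w => (E2 w).2.2).
  by apply/regular_snd/(regular_snd rE2).
have uP1 w : S w -> P1' w \in unitmx by case/gen1/and3P.
have uP2 w : S w -> P2' w \in unitmx by case/gen2/and3P.
have uM1 w : S w -> frame (x1' w) (X1 w) \in unitmx by case/gen1/and3P.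
have uM2 w : S w -> frame (x2' w) (X2 w) \in unitmx by case/gen2/and3P.
have gen1' w : S w -> generic (reduced_form (P1' w) (x1' w) (X1 w) (Y1 w))
    (reduced_vec (P1' w) (x1' w) (X1 w) (Y1 w)) (E1 w).2.2.
  by case/gen1/and3P.
have gen2' w : S w -> generic (reduced_form (P2' w) (x2' w) (X2 w) (Y2 w))
    (reduced_vec (P2' w) (x2' w) (X2 w) (Y2 w)) (E2 w).2.2.
  by case/gen2/and3P.
have [rform1 rvec1] := regular_reduced (rP1 : regular_map S P1')
  (rx1 : regular_map S x1') rX1 rY1 uM1.
have [rform2 rvec2] := regular_reduced (rP2 : regular_map S P2')
  (rx2 : regular_map S x2') rX2 rY2 uM2.
have sk1 w : S w -> (reduced_form (P1' w) (x1' w) (X1 w) (Y1 w))^T =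
    - reduced_form (P1' w) (x1' w) (X1 w) (Y1 w).
  by move=> Sw; apply/reduced_form_skew/skP1.
have sk2 w : S w -> (reduced_form (P2' w) (x2' w) (X2 w) (Y2 w))^T =
    - reduced_form (P2' w) (x2' w) (X2 w) (Y2 w).
  by move=> Sw; apply/reduced_form_skew/skP2.
have rC := IHn _ _ _ _ _ _ rform1 rvec1 rE1' rform2 rvec2 rE2' sk1 sk2
  gen1' gen2'.
set C := (fun w => transporter _ _ _ _ _ _) in rC.
have uC w : S w -> top_mx (C w) \in unitmx.
  move=> Sw; apply: GL_tower_top.
  by case: (transporterP two_neq0 (sk1 w Sw) (sk2 w Sw) (gen1' w Sw) (gen2' w Sw)).
pose N1 w := kernel_frame (P1' w) (x1' w) (X1 w) (Y1 w).
pose N2 w := kernel_frame (P2' w) (x2' w) (X2 w) (Y2 w).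
have uN1 w : S w -> N1 w \in unitmx.
  move=> Sw; apply: (kernel_frame_unit two_neq0 (skP1 w Sw) (uP1 w Sw) (uM1 w Sw)).
  exact: generic_unit (gen1' w Sw).
have uN2 w : S w -> N2 w \in unitmx.
  move=> Sw; apply: (kernel_frame_unit two_neq0 (skP2 w Sw) (uP2 w Sw) (uM2 w Sw)).
  exact: generic_unit (gen2' w Sw).
have rN1 : regular_map S N1.
  by apply: regular_row_mx => //; apply: regular_kernel_vec.
have rN2 : regular_map S N2.
  by apply: regular_row_mx => //; apply: regular_kernel_vec.
have rB := regular_transport_mx rN1 rN2 (regular_top_mx rC) uN1 uC.
have uB w : S w -> transport_mx (N1 w) (N2 w) (top_mx (C w)) \in unitmx.
  by move=> Sw; apply: transport_mx_unit; [exact: uN1|exact: uC|exact: uN2].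
have rM1 := regular_frame (rx1 : regular_map S x1') rX1.
have rM2 := regular_frame (rx2 : regular_map S x2') rX2.
have rA := regular_transport_mx rM1 rM2 rB uM1 uB.
exact: regular_pair rA (regular_pair rB rC).
Qed.

End RegularFrames.

(** * The group and its representation *)

Section TowerGroup.
Variable K : closedFieldType.

Lemma top_mx_mul m (A B : sq_tower K m) :
  top_mx (tower_mul A B) = top_mx A *m top_mx B.
Proof. by case: m A B => // A B; rewrite [LHS]flatmx0 [RHS]flatmx0. Qed.

Lemma top_mx_one m : top_mx (tower_one K m) = 1%:M.
Proof. by case: m. Qed.

Lemma top_mx_inv m (A : sq_tower K m) : top_mx (tower_inv A) = invmx (top_mx A).
Proof. by case: m A => // A; rewrite [LHS]flatmx0 [RHS]flatmx0. Qed.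

Lemma GL_tower_one m : GL_tower (tower_one K m).
Proof. by elim: m => // m IHm; split; first exact: unitmx1. Qed.

Lemma GL_tower_mul m (A B : sq_tower K m) :
  GL_tower A -> GL_tower B -> GL_tower (tower_mul A B).
Proof.
elim: m A B => // m IHm A B [uA GA] [uB GB].
by split; [rewrite unitmx_mul uA|apply: IHm].
Qed.

Lemma GL_tower_inv m (A : sq_tower K m) : GL_tower A -> GL_tower (tower_inv A).
Proof.
by elim: m A => // m IHm A [uA GA]; split; [rewrite unitmx_inv|apply: IHm].
Qed.

Lemma tower_mulA m (A B C : sq_tower K m) :
  tower_mul A (tower_mul B C) = tower_mul (tower_mul A B) C.
Proof. by elim: m A B C => //= m IHm A B C; rewrite mulmxA IHm. Qed.

Lemma tower_mul1 m (A : sq_tower K m) : tower_mul (tower_one K m) A = A.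
Proof.
elim: m A => [|m IHm] A /=; first by rewrite [LHS]flatmx0 [RHS]flatmx0.
by rewrite mul1mx IHm -surjective_pairing.
Qed.

Lemma tower_mulr1 m (A : sq_tower K m) : tower_mul A (tower_one K m) = A.
Proof.
elim: m A => [|m IHm] A //=; by rewrite mulmx1 IHm -surjective_pairing.
Qed.

Lemma tower_mulV m (A : sq_tower K m) :
  GL_tower A -> tower_mul (tower_inv A) A = tower_one K m.
Proof.
elim: m A => [|m IHm] A /=; first by rewrite [A]flatmx0 [RHS]flatmx0.
by move=> [uA GA]; rewrite mulVmx // IHm.
Qed.

Lemma tower_mulrV m (A : sq_tower K m) :
  GL_tower A -> tower_mul A (tower_inv A) = tower_one K m.
Proof.
elim: m A => [|m IHm] A /=; first by rewrite [A]flatmx0 [RHS]flatmx0.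
by move=> [uA GA]; rewrite mulmxV // IHm.
Qed.

Lemma E_act_one m (X : E_tower K m) : E_act (tower_one K m) X = X.
Proof.
elim: m X => //= m IHm X.
by rewrite top_mx_one mul1mx trmx1 mulmx1 IHm -surjective_pairing.
Qed.

Lemma E_act_mul m (A B : sq_tower K m) (X : E_tower K m) :
  E_act (tower_mul A B) X = E_act A (E_act B X).
Proof.
elim: m A B X => //= m IHm A B X.
by rewrite IHm top_mx_mul trmx_mul !mulmxA.
Qed.

Lemma E_act_linear m (A : sq_tower K m) : linear (E_act A).
Proof.
elim: m A => //= m IHm A a u v.
congr (_, _); last exact: IHm.
by rewrite mulmxDr mulmxDl -scalemxAr -scalemxAl.
Qed.

Section Regularity.
Variables (W : vectType K) (S : set W).

Lemma regular_tower_mul m (f g : W -> sq_tower K m) :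
  regular_map S f -> regular_map S g ->
  regular_map S (fun w => tower_mul (f w) (g w)).
Proof.
elim: m f g => [|m IHm] f g rf rg //=.
apply: regular_pair.
  by apply: regular_mulmx; [apply: regular_fst rf|apply: regular_fst rg].
by apply: IHm; [apply: regular_snd rf|apply: regular_snd rg].
Qed.

Lemma regular_tower_inv m (f : W -> sq_tower K m) :
  (forall w, S w -> GL_tower (f w)) -> regular_map S f ->
  regular_map S (fun w => tower_inv (f w)).
Proof.
elim: m f => [|m IHm] f Gf rf //=.
apply: regular_pair.
  by apply: regular_invmx; [move=> w /Gf[]|apply: regular_fst rf].
by apply: IHm; [move=> w /Gf[]|apply: regular_snd rf].
Qed.

Lemma regular_E_act m (f : W -> sq_tower K m) (X : W -> E_tower K m) :
  regular_map S f -> regular_map S X ->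
  regular_map S (fun w => E_act (f w) (X w)).
Proof.
elim: m f X => [|m IHm] f X rf rX //=.
have rf2 := regular_snd rf; have rX2 := regular_snd rX.
apply: regular_pair; last exact: IHm.
apply: regular_mulmx; last exact/regular_trmx/regular_top_mx.
by apply: regular_mulmx; [apply: regular_fst rf|apply: regular_fst rX].
Qed.

End Regularity.

Section Symplectic.
Variable n : nat.
Local Notation Om := (omega_mx K n).

(** In this form the symplectic condition is the invariance of omega_mx as a
    bivector, the law under which all the data transform. *)
Lemma SpE (A : 'M[K]_n.*2) : Sp A <-> A *m Om *m A^T = Om.
Proof.
(* the two Gram conditions are exchanged by transposition, since the inverse
   of the Gram matrix is its opposite *)
have flip (B : 'M[K]_n.*2) : B^T *m Om *m B = Om -> B *m Om *m B^T = Om.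
  move=> BOB.
  have : - (Om *m B^T *m Om) *m B = 1%:M.
    by rewrite mulNmx -!mulmxA [B^T *m _]mulmxA BOB omega_mx_sqr opprK.
  move/mulmx1C => BO.
  rewrite -[LHS]mulmx1 -[1%:M]opprK -omega_mx_sqr mulmxN mulmxA -mulNmx.
  by move: BO; rewrite mulmxN !mulmxA => ->; rewrite mul1mx.
have omegaE (B : 'M[K]_n.*2) x y :
    omega (B *m x) (B *m y) = (x^T *m (B^T *m Om *m B) *m y) 0 0.
  by rewrite /omega trmx_mul !mulmxA.
split=> [[_ omA]|AOA].
  apply: flip; apply/matrixP => i j.
  have := omA (delta_mx i 0) (delta_mx j 0); rewrite omegaE /omega !trmx_delta.
  by rewrite -!rowE -!colE !mxE.
have AOA' := flip A^T; rewrite trmxK in AOA'; split.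
  have : A *m (Om *m A^T *m - Om) = 1%:M.
    by rewrite !mulmxN !mulmxA AOA omega_mx_sqr opprK.
  by case/mulmx1_unit.
by move=> x y; rewrite omegaE AOA'.
Qed.

Lemma SpGL_transports g v1 v2 (E1 E2 : E_tower K n.*2) :
  SpGL g /\ V_act g (v1, E1) = (v2, E2) <-> transports Om v1 E1 Om v2 E2 g.
Proof.
split=> [[[/SpE Spg GLg] [gv gE]]|[GLg Spg gv gE]]; first by split.
by split; [split=> //; apply/SpE|rewrite /V_act /= gv gE].
Qed.

Lemma SpGL_one : SpGL (tower_one K n.*2).
Proof.
split; last exact: GL_tower_one.
by apply/SpE; rewrite top_mx_one trmx1 mul1mx mulmx1.
Qed.

Lemma SpGL_mul g h : SpGL g -> SpGL h -> @SpGL K n (tower_mul g h).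
Proof.
move=> [/SpE Spg GLg] [/SpE Sph GLh]; split; last exact: GL_tower_mul.
apply/SpE; rewrite top_mx_mul trmx_mul.
by rewrite -{2}Spg -{2}Sph !mulmxA.
Qed.

Lemma SpGL_inv g : SpGL g -> @SpGL K n (tower_inv g).
Proof.
move=> [/SpE Spg GLg]; split; last exact: GL_tower_inv.
have ug := GL_tower_top GLg; apply/SpE; rewrite top_mx_inv -{1}Spg !mulmxA.
by rewrite mulVmx // mul1mx trmx_inv mulmxK // unitmx_tr.
Qed.

Lemma V_act_one v : V_act (tower_one K n.*2) v = v :> V_Sp K n.
Proof.
by rewrite /V_act top_mx_one mul1mx E_act_one -surjective_pairing.
Qed.

Lemma V_act_mul g h v : V_act (tower_mul g h) v = V_act g (V_act h v) :> V_Sp K n.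
Proof. by rewrite /V_act /= top_mx_mul mulmxA E_act_mul. Qed.

Lemma V_act_linear g : linear (@V_act K n g).
Proof.
move=> a u v; congr (_, _); last exact: E_act_linear.
by rewrite /= mulmxDr -scalemxAr.
Qed.

Lemma regular_V_act (W : vectType K) (S : set W) (f : W -> sq_tower K n.*2) v :
  regular_map S f -> regular_map S (fun w => V_act (f w) v : V_Sp K n).
Proof.
move=> rf; apply: regular_pair.
  by apply: regular_mulmx; [exact: regular_top_mx|exact: regular_map_cst].
by apply: regular_E_act => //; apply: regular_map_cst.
Qed.

Lemma SpGL_locally_closed : locally_closed (@SpGL K n).
Proof.
pose gram (g : sq_tower K n.*2) := top_mx g *m Om *m (top_mx g)^T - Om.
pose P := [set f : sq_tower K n.*2 -> K | exists i j, f = (fun g => gram g i j)].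
have rtop := regular_top_mx (@regular_map_id _ _ (@setT (sq_tower K n.*2))).
have [f [i [j ->]]|F Fcl FE] := @relatively_closed _ _ setT P.
  apply: (@regular_ext _ _ _ (fun g =>
      (top_mx g *m Om *m (top_mx g)^T) i j + - Om i j)).
    by move=> g _; rewrite /gram [RHS]mxE [X in _ = _ + X]mxE.
  apply: regularD; last exact: regular_cst.
  apply: regular_entry; apply: regular_mulmx; last exact: regular_trmx.
  by apply: regular_mulmx => //; apply: regular_map_cst.
have GLo := open_GL_tower (@zariski_openT K _)
  (@regular_map_id K (sq_tower K n.*2) setT).
rewrite setTI in GLo; rewrite !setTI in FE.
exists F, [set g | GL_tower g]; split=> //.
rewrite -FE; apply/seteqP; split=> g /=.
  move=> [/SpE Spg GLg]; split=> // _ [i [j ->]].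
  by rewrite /gram Spg subrr mxE.
move=> [gP GLg]; split=> //; apply/SpE/eqP; rewrite -subr_eq0.
apply/eqP/matrixP => i j; rewrite [RHS]mxE.
by apply: (gP (fun h => gram h i j)); exists i, j.
Qed.

Lemma SpGL_algebraic :
  algebraic_group (@SpGL K n) (@tower_mul K n.*2) (tower_one K n.*2)
    (@tower_inv K n.*2).
Proof.
split.
- exact: SpGL_locally_closed.
- by split; [exact: SpGL_one|exact: SpGL_mul|exact: SpGL_inv].
- split=> [g h k _ _ _|g _|g [_ GLg]]; first exact: tower_mulA.
    by rewrite tower_mul1 tower_mulr1.
  by rewrite tower_mulV // tower_mulrV.
- apply: regular_tower_mul; [apply: regular_fst|apply: regular_snd];
  exact: regular_map_id.
- by apply: regular_tower_inv; [move=> g []|exact: regular_map_id].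
Qed.

Lemma V_act_rational :
  rational_representation (@SpGL K n) (@tower_mul K n.*2) (tower_one K n.*2)
    (@V_act K n).
Proof.
split=> [g _|v|g h _ _ v|].
- exact: V_act_linear.
- exact: V_act_one.
- exact: V_act_mul.
apply: regular_linfun => [g|v]; first exact: V_act_linear.
by apply: regular_V_act; apply: regular_map_id.
Qed.

Hypothesis two_neq0 : 2%:R != 0 :> K.

(** The open orbit of V. *)
Definition generic_locus : set (V_Sp K n) := [set v | generic Om v.1 v.2].

(** An element of the group carrying one vector to another is a transport of
    data with both bivectors standard, so existence and uniqueness of
    transporters apply. *)
Lemma generic_locus_orbit v : generic_locus v ->
  orbit_of (@SpGL K n) (@V_act K n) v = generic_locus.
Proof.
case: v => x E genv; apply/seteqP; split=> [_ [g Gg <-]|[y F] genw].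
  rewrite [V_act _ _]surjective_pairing.
  have /SpGL_transports tr : SpGL g /\
    V_act g (x, E) = ((V_act g (x, E)).1, (V_act g (x, E)).2) by [].
  by have [] := transporter_unique two_neq0 (omega_mx_skew _ _) genv tr.
have skO := omega_mx_skew K n.
have /SpGL_transports[Gg gv] := transporterP two_neq0 skO skO genv genw.
by exists (transporter Om x E Om y F).
Qed.

Lemma generic_locus_open : zariski_open generic_locus.
Proof.
have := @open_generic K (V_Sp K n) n setT (fun=> Om) fst snd (@zariski_openT _ _).
rewrite setTI; apply; first exact: regular_map_cst.
  exact: regular_fst (@regular_map_id _ _ _).
exact: regular_snd (@regular_map_id _ _ _).
Qed.

Lemma generic_locus_nonempty : generic_locus !=set0.
Proof. by have [x [E gen]] := generic_omega K n; exists (x, E). Qed.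

Lemma generic_stabilizer v : generic_locus v ->
  [set g | SpGL g /\ V_act g v = v] = [set tower_one K n.*2].
Proof.
case: v => x E genv; apply/seteqP; split=> g /=; last first.
  by move=> ->; split; [exact: SpGL_one|exact: V_act_one].
move=> /SpGL_transports trg.
have /SpGL_transports tr1 : SpGL (tower_one K n.*2) /\
  V_act (tower_one K n.*2) (x, E) = (x, E).
  by split; [exact: SpGL_one|exact: V_act_one].
have skO := omega_mx_skew K n.
have [_ <-] := transporter_unique two_neq0 skO genv trg.
by have [_ ->] := transporter_unique two_neq0 skO genv tr1.
Qed.

(** The orbit map of a generic vector is an isomorphism from the group onto
    the generic locus, the transporter being its inverse. *)
Lemma SpGL_dim : has_dim (@SpGL K n) (\dim {:V_Sp K n}).
Proof.
have [[x E] genv] := generic_locus_nonempty.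
have skO := omega_mx_skew K n.
have gen_act g : SpGL g -> generic_locus (V_act g (x, E)).
  by move=> Gg; rewrite -(generic_locus_orbit genv); exists g.
apply: (@has_dim_iso _ _ _ _ generic_locus (fun g => V_act g (x, E))
  (fun v => transporter Om x E Om v.1 v.2)).
- by apply: regular_V_act; apply: regular_map_id.
- apply: regular_transporter => //; try exact: regular_map_cst.
  + exact: regular_fst (@regular_map_id _ _ _).
  + exact: regular_snd (@regular_map_id _ _ _).
- exact: gen_act.
- move=> [y F] genw.
  by have /SpGL_transports[] := transporterP two_neq0 skO skO genv genw.
- move=> g Gg; have /SpGL_transports tr : SpGL g /\
    V_act g (x, E) = ((V_act g (x, E)).1, (V_act g (x, E)).2) by [].
  by have [_ ->] := transporter_unique two_neq0 skO genv tr.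
- move=> [y F] genw.
  by have /SpGL_transports[] := transporterP two_neq0 skO skO genv genw.
exact: has_dim_open generic_locus_open generic_locus_nonempty.
Qed.

Lemma SpGL_super_etale :
  super_etale_module (@SpGL K n) (@tower_mul K n.*2) (tower_one K n.*2)
    (@tower_inv K n.*2) (@V_act K n).
Proof.
have [v0 gen0] := generic_locus_nonempty.
have orb0 := generic_locus_orbit gen0.
split.
  split; [exact: SpGL_algebraic|exact: V_act_rational| |exact: SpGL_dim].
  by exists v0; rewrite orb0; exact: generic_locus_open.
move=> v vo; apply: generic_stabilizer.
have vv : orbit_of (@SpGL K n) (@V_act K n) v v.
  by exists (tower_one K n.*2); [exact: SpGL_one|exact: V_act_one].
(* the open orbit of v meets the generic locus, which is invariant *)
have [|w [[h Gh <-] genw]] := zariski_open_meet vo generic_locus_open _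
  generic_locus_nonempty; first by exists v.
rewrite -(generic_locus_orbit genw); exists (tower_inv h); first exact: SpGL_inv.
by case: Gh => _ GLh; rewrite -V_act_mul tower_mulV // V_act_one.
Qed.

End Symplectic.
End TowerGroup.

Theorem theorem2p4 (R : realType) (n : nat) (hn : (1 <= n)%N) :
  super_etale_module (@SpGL R[i] n) (@tower_mul R[i] n.*2)
    (tower_one R[i] n.*2) (@tower_inv R[i] n.*2) (@V_act R[i] n).
Proof. by apply: SpGL_super_etale; rewrite Num.Theory.pnatr_eq0. Qed.
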